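(* Let $p$ be a prime and $K$ a finite extension of $\mathbb{Q}_p$. Suppose one of the following: (1) $\pi\in\mathcal{M}_K\setminus\{0\}$, $h(T)=h(T;\pi)$, $\rho=|\pi|$, and $\kappa$ is a partition with $\kappa_1+l(\kappa)\le p$. (2) $g$ is an integer with $0<g<p$, $\vec{\pi}=(\pi_i)_{i=1}^g\in\mathcal{M}_K^{\oplus g}$ with $|\pi_i|\le|\pi_g|$ for all $i=1,2,\ldots,g-1$; $\boldsymbol{\mu}=(1,2,\ldots,g)$, $h(T)=h_{\boldsymbol{\mu}}(T;\vec{\pi})$, $\rho=|\pi_g|^{1/g}$, and $\kappa=(g,0,0,\ldots)$. Then $h(T)\in\Gamma_+\cap\Gamma_\rho$ and $|S_\kappa(h(T))|=\rho^{|\kappa|}$. Consequently, $h(T)W^{\mathrm{alg}}\cap T^{-i(W^{\mathrm{alg}})}K[[\frac1T]]=0$ for any $W\in\mathrm{Gr}^{\mathrm{an}}(K)$ such that $W^{\mathrm{alg}}$ is strictly integral and $\kappa=\kappa(W^{\mathrm{alg}})$.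
   Context: $|\cdot|$ is the absolute value on $K$ with $|p|=1/p$, $O_K=\{a\in K:|a|\le1\}$, $\mathcal{M}_K=\{a\in K:|a|<1\}$. Partitions and Schur functions: a partition is a non-increasing sequence $\kappa=(\kappa_i)_{i\ge1}$ of non-negative integers, eventually $0$; $l(\kappa)$ is the number of nonzero terms and $|\kappa|=\sum\kappa_i$. For $h(T)=\sum_{i\ge0}h_iT^i$ with $h_0=1$ (and $h_i=0$ for $i<0$), $S_\kappa(h):=\det(h_{\kappa_i-i+j})_{i,j=1}^{l(\kappa)}$. Loops: $l(T):=\sum_{k\ge0}p^{-k}T^{p^k}$, $h(T;\pi):=\exp(l(\pi T))$ for $\pi\in\mathcal{M}_K$, and $h_{\boldsymbol{\mu}}(T;\vec{\pi}):=\prod_{i=1}^gh(T^{\mu_i};\pi_i)$ for a sequence of positive integers $\boldsymbol{\mu}=(\mu_1,\ldots,\mu_g)$ and $\vec{\pi}\in\mathcal{M}_K^{\oplus g}$. $H:=\{\sum_{i\in\mathbb{Z}}a_iT^i : a_i\in K,\ \sup|a_i|<\infty,\ \lim_{i\to+\infty}|a_i|=0\}$, a field, with norm $\|\sum a_iT^i\|=\sup|a_i|$. $H_+$ (resp. $H_-$) is the closed subspace of series with $a_i=0$ for $i\le0$ (resp. $i>0$). For $0\le\rho<1$, $\Gamma_\rho:=\{h=\sum h_iT^i\in H^* : \|h\|=|h_0|=1,\ |h_i|\le\rho^i\ \forall i>0\}$; $\Gamma:=\bigcup_{0\le\rho<1}\Gamma_\rho$; $\Gamma_+:=\{h\in\Gamma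 : h_0=1,\ h_i=0\ \forall i<0\}$. Algebraic Grassmannian: $K((\frac1T))$ is the field of series $\sum_{i\le n}v_iT^i$; the degree is the largest exponent with nonzero coefficient, and a series is monic if its leading coefficient is $1$. For a $K$-subspace $V$ put $\underline{M}(V)=\{\deg v : 0\ne v\in V\}$. $\mathrm{Gr}^{\mathrm{alg}}(K)$ is the set of $K$-subspaces $V$ for which $V\cap K[[\frac1T]]$ and $K((\frac1T))/(V+K[[\frac1T]])$ are finite dimensional. For such $V$ write $\underline{M}(V)=\{s_1<s_2<\cdots\}$; the index is $i(V)=|\underline{M}(V)\cap\mathbb{Z}_{\le0}|-|\mathbb{Z}_{>0}\setminus\underline{M}(V)|$ and the partition $\kappa(V)$ is given by $\kappa_j(V)=j-i(V)-s_j$. The standard basis of $V$ is the unique basis $v_i(T)=\sum_jv_{ij}T^j$ ($i\ge1$) with $v_i$ monic of degree $s_i$ and $v_{i,s_j}=0$ for $i>j\ge1$. $V$ is strictly integral if all coefficients $v_{ij}$ lie in $O_K$. $p$-adic Grassmannian: $\mathrm{Gr}^{\mathrm{an}}(K)$ is the set of $K$-subspaces $W\subset H$ that are the image of an injective $K$-linear map $w:H_+\to H$ such that, for some $i_0\in\mathbb{Z}$, $T^{i_0}w=w_1\oplus(1+w_2):H_+\to H_-\oplus H_+=H$ with $w_1:H_+\to H_-$ $K$-linear, $\|w_1\|\le1$, and $w_2:H_+\to H_+$ $K$-linear, $\|w_2\|\le1$, a uniform limit of bounded finite-rank operators. For $W\in\mathrm{Gr}^{\mathrm{an}}(K)$,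 $W^{\mathrm{alg}}:=W\cap K((\frac1T))$ (intersection in $\prod_{i\in\mathbb{Z}}KT^i$), which is an element of $\mathrm{Gr}^{\mathrm{alg}}(K)$. $\Gamma$ acts on $\mathrm{Gr}^{\mathrm{an}}(K)$ by multiplication, and $h(T)W^{\mathrm{alg}}:=(h(T)W)^{\mathrm{alg}}$.
   Formalization: The ''Consequently'' clause is stated only for ρ > 0, i.e. π_g ≠ 0 in case (2); if π_g = 0 then h = 1 and it fails, e.g. for W the closed span of T^{1-g}, T^2, T^3, …. *)

(* Defs.v *)
From HB Require Import structures.
From mathcomp Require Import all_boot all_order all_algebra all_field.
From mathcomp Require Import finmap.
From mathcomp Require Import all_classical all_reals all_analysis.

Set Implicit Arguments.
Unset Strict Implicit.
Unset Printing Implicit Defensive.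

Import Order.TTheory GRing.Theory Num.Theory.
Import numFieldTopology.Exports.

Local Open Scope classical_set_scope.
Local Open Scope ring_scope.

Section AbsoluteValues.
Variable R : realType.

Record nonarchimedean_abs (F : fieldType) (v : F -> R) : Prop := {
  abs_ge0 : forall x, 0 <= v x;
  abs_eq0 : forall x, v x = 0 <-> x = 0;
  absM : forall x y, v (x * y) = v x * v y;
  abs_ultra : forall x y, v (x + y) <= Num.max (v x) (v y) }.

Definition abs_cvg (F : fieldType) (v : F -> R) (u : nat -> F) (l : F) : Prop :=
  v (u n - l) @[n --> \oo] --> 0.

Definition abs_cauchy (F : fieldType) (v : F -> R) (u : nat -> F) : Prop :=
  forall e : R, 0 < e ->
  exists N, forall m n, (N <= m)%N -> (N <= n)%N -> v (u m - u n) < e.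

Definition padic_abs (p : nat) (q : rat) : R :=
  if q == 0 then 0
  else p%:R ^+ logn p `|denq q|%N / p%:R ^+ logn p `|numq q|%N.

(* (F, v) is the completion of the rationals for the p-adic absolute value;
   this determines (F, v) up to a unique isometric isomorphism. *)
Record is_Qp (p : nat) (F : fieldType) (v : F -> R) : Prop := {
  Qp_abs : nonarchimedean_abs v;
  Qp_rat : forall q : rat, v (ratr q) = padic_abs p q;
  Qp_dense : forall (x : F) (e : R), 0 < e -> exists q : rat, v (x - ratr q) < e;
  Qp_complete : forall u, abs_cauchy v u -> exists l, abs_cvg v u l }.

End AbsoluteValues.

(* Parts are indexed from 0: [part i] is the (i+1)-st part. *)
Record int_partition := IntPartition {
  part :> nat -> nat;
  part_noninc : forall i j, (i <= j)%N -> (part j <= part i)%N;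
  part_eventually0 : exists N, forall i, (N <= i)%N -> part i = 0%N }.

Definition plength (kappa : int_partition) : nat :=
  #|` fset_set [set i : nat | kappa i <> 0%N] |.

Definition pweight (kappa : int_partition) : nat :=
  \big[addn/0%N]_(i \in [set: nat]) kappa i.

Section PowerSeries.
Variable K : fieldType.
Implicit Types f g : nat -> K.

Definition psone : nat -> K := fun n => (n == 0%N)%:R.

Definition psmul f g : nat -> K := fun n => \sum_(i < n.+1) f i * g (n - i)%N.

Definition pspow f k : nat -> K := iter k (psmul f) psone.

(* The exponential of a power series without constant term: f^k has no
   coefficient in degree n < k, so the sum over k <= n is the full one. *)
Definition psexp f : nat -> K :=
  fun n => \sum_(k < n.+1) pspow f k n / k`!%:R.

(* f(a T) *)
Definition psscale (a : K) f : nat -> K := fun n => a ^+ n * f n.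

(* f(T^m), for m > 0 *)
Definition psTpow (m : nat) f : nat -> K :=
  fun n => if (m %| n)%N then f (n %/ m)%N else 0.

(* For p > 1, at most one k satisfies p^k = n, and then k <= n. *)
Definition lseries (p : nat) : nat -> K :=
  fun n => \sum_(k < n.+1 | (p ^ k)%N == n) (p%:R ^+ k)^-1.

Definition hseries (p : nat) (pi : K) : nat -> K :=
  psexp (psscale pi (lseries p)).

Definition hmuseries (p g : nat) (mu : 'I_g -> nat) (pi : 'I_g -> K) : nat -> K :=
  \big[psmul/psone]_(i < g) psTpow (mu i) (hseries p (pi i)).

(* Two-sided formal series: a stands for the sum over i in Z of (a i) T^i.
   The codomain K^o makes this a K-module for the pointwise operations. *)
Definition biseries := int -> K^o.

Definition of_ps f : biseries := fun i => if i is Posz n then f n else 0.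

Definition schur (kappa : int_partition) (h : biseries) : K :=
  \det (\matrix_(i < plength kappa, j < plength kappa)
          (h ((kappa i)%:Z - i%:Z + j%:Z) : K)).

Definition Tshift (m : int) (a : biseries) : biseries := fun i => a (i - m).

Definition linear_on (D : set biseries) (f : biseries -> biseries) : Prop :=
  forall c x y, D x -> D y -> f (c *: x + y) = c *: f x + f y.

Definition finite_dim (V : set biseries) : Prop :=
  exists (n : nat) (e : 'I_n -> biseries), (forall i, V (e i)) /\
    forall x, V x -> exists c : 'I_n -> K, x = \sum_(i < n) c i *: e i.

Definition is_basis (V : set biseries) (b : nat -> biseries) : Prop :=
  [/\ forall i, V (b i),
      forall x, V x ->
        exists (n : nat) (c : 'I_n -> K), x = \sum_(i < n) c i *: b i &
      forall (n : nat) (c : 'I_n -> K),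
        \sum_(i < n) c i *: b i = 0 -> forall i, c i = 0].

(* T^m K[[1/T]] *)
Definition Tpow_Kinv (m : int) : set biseries :=
  [set a | forall i, m < i -> a i = 0].

(* K((1/T)) *)
Definition laurent : set biseries := [set a | exists m, Tpow_Kinv m a].

Definition has_degree (a : biseries) (d : int) : Prop :=
  a d <> 0 /\ forall i, d < i -> a i = 0.

Definition degrees (V : set biseries) : set int :=
  [set d | exists2 x, V x & has_degree x d].

(* Both sets are finite when V belongs to the algebraic Grassmannian. *)
Definition gr_index (V : set biseries) : int :=
  (#|` fset_set (degrees V `&` [set d | d <= 0]) |)%:Z
  - (#|` fset_set ([set d | 0 < d] `\` degrees V) |)%:Z.

(* [sdeg V j] is s_{j+1}: the increasing enumeration of the degrees of V. *)
Definition sdeg (V : set biseries) : nat -> int :=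
  xget (fun=> 0) [set s : nat -> int |
    (forall i j, (i < j)%N -> s i < s j) /\ range s = degrees V].

Definition kappa_of (V : set biseries) (j : nat) : int :=
  j.+1%:Z - gr_index V - sdeg V j.

Definition is_standard_basis (V : set biseries) (b : nat -> biseries) : Prop :=
  [/\ is_basis V b,
      forall i, has_degree (b i) (sdeg V i) /\ b i (sdeg V i) = 1 &
      forall i j, (j < i)%N -> b i (sdeg V j) = 0].

Definition alg (W : set biseries) : set biseries := W `&` laurent.

End PowerSeries.

Section PadicGrassmannian.
Variables (R : realType) (K : fieldType) (v : K -> R).
Implicit Types a b h : biseries K.

Definition strictly_integral (V : set (biseries K)) : Prop :=
  exists2 b, is_standard_basis V b & forall i j, v (b i j) <= 1.

Definition Hspace : set (biseries K) :=
  [set a | has_ubound (range (fun i => v (a i))) /\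
           v (a n%:Z) @[n --> \oo] --> 0].

Definition Hnorm a : R := sup (range (fun i => v (a i))).

Definition Hplus : set (biseries K) :=
  Hspace `&` [set a | forall i, i <= 0 -> a i = 0].

Definition Hminus : set (biseries K) :=
  Hspace `&` [set a | forall i, 0 < i -> a i = 0].

Definition abs_lim (u : nat -> K) : K := xget 0 [set l | abs_cvg v u l].

(* The n-th coefficient is the sum over i in Z of a_i b_(n-i); it converges
   unconditionally for a and b in H, so symmetric partial sums suffice. *)
Definition Hmul a b : biseries K := fun n =>
  abs_lim (fun N => \sum_(k < N.*2.+1)
    let i := k%:Z - N%:Z in (a i : K) * b (n - i)).

Definition Gamma_rho (rho : R) : set (biseries K) :=
  [set h | [/\ Hspace h, h <> 0, Hnorm h = 1, v (h 0) = 1 &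
               forall n : nat, (0 < n)%N -> v (h n%:Z) <= rho ^+ n]].

Definition Gamma : set (biseries K) :=
  \bigcup_(rho in [set r : R | 0 <= r < 1]) Gamma_rho rho.

Definition Gamma_plus : set (biseries K) :=
  [set h | [/\ Gamma h, h 0 = 1 & forall i, i < 0 -> h i = 0]].

(* Operator norm of a map defined on Hplus. *)
Definition opnorm (f : biseries K -> biseries K) : \bar R :=
  ereal_sup [set (Hnorm (f x) / Hnorm x)%:E | x in Hplus `\ 0].

Definition bounded_finite_rank (f : biseries K -> biseries K) : Prop :=
  [/\ set_fun Hplus Hplus f, linear_on Hplus f,
      (opnorm f < +oo)%E & finite_dim (f @` Hplus)].

Definition unif_lim_finite_rank (f : biseries K -> biseries K) : Prop :=
  exists2 F : nat -> biseries K -> biseries K,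
    forall n, bounded_finite_rank (F n) &
    opnorm (fun x => F n x - f x) @[n --> \oo] --> 0%E.

Definition Gr_an (W : set (biseries K)) : Prop :=
  exists w : biseries K -> biseries K,
    [/\ set_fun Hplus Hspace w, linear_on Hplus w, set_inj Hplus w,
        W = w @` Hplus &
        exists (i0 : int) (w1 w2 : biseries K -> biseries K),
          [/\ set_fun Hplus Hminus w1 /\ linear_on Hplus w1,
              (opnorm w1 <= 1)%E,
              set_fun Hplus Hplus w2 /\ linear_on Hplus w2,
              (opnorm w2 <= 1)%E /\ unif_lim_finite_rank w2 &
              forall x, Hplus x -> Tshift i0 (w x) = w1 x + (x + w2 x)]].

Definition Hact h (W : set (biseries K)) : set (biseries K) := Hmul h @` W.

End PadicGrassmannian.

(* Main.v *)
Require Import Defs.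
From HB Require Import structures.
From mathcomp Require Import all_boot all_order all_algebra all_field.
From mathcomp Require Import finmap.
From mathcomp Require Import all_classical all_reals all_analysis.
From mathcomp Require Import perm zify ring.

Set Implicit Arguments.
Unset Strict Implicit.
Unset Printing Implicit Defensive.

Import Order.TTheory GRing.Theory Num.Theory.
Import numFieldTopology.Exports.

Local Open Scope classical_set_scope.
Local Open Scope ring_scope.

(* The series h(T; pi) is F(pi T) for F the Artin-Hasse exponential, which has
   p-integral coefficients by Dwork's argument and coefficients 1/n! for n < p.
   Hence, when kappa_1 + l(kappa) <= p, the Schur function of h is
   pi^|kappa| det(1/(kappa_i - i + j)!), and this determinant is a Vandermonde
   determinant divided by factorials of integers less than p: a p-adic unit.
   In the second case S_kappa(h) = h_g is congruent to pi_g modulo pi_g^2.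

   For the last claim, W^alg is dense in W, so that every y in W obeys the same
   constraint as the elements of W^alg: off the degrees s_1 < s_2 < ..., a
   coefficient of y is bounded by the y_{s_j} at larger degrees. Suppose that
   hy has no coefficient in degrees > -i(W^alg), and put
   mu = max_j |y_{s_j}| rho^(kappa_j - j) over j <= l(kappa). The rows of the
   equation beyond l(kappa) bound the tail of y by mu; the first l(kappa) rows
   then say that the matrix (h_{kappa_i - i + j}) sends (y_{s_i}) to a vector
   smaller by a factor rho than its entries allow, and Cramer's rule with
   |S_kappa(h)| = rho^|kappa| gives mu <= rho mu, whence mu = 0 and y = 0. *)

(** * Non-archimedean absolute values *)

Section Abs.
Variables (R : realType) (K : fieldType) (v : K -> R).
Hypothesis v_abs : nonarchimedean_abs v.

Lemma abs0 : v 0 = 0. Proof. exact/(abs_eq0 v_abs). Qed.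

Lemma abs_neq0 x : x != 0 -> v x != 0.
Proof. by apply: contra_neq => /(abs_eq0 v_abs). Qed.

Lemma abs1 : v 1 = 1.
Proof. by apply: (mulfI (abs_neq0 (oner_neq0 K))); rewrite -(absM v_abs) !mulr1. Qed.

Lemma absX x n : v (x ^+ n) = v x ^+ n.
Proof. by elim: n => [|n IH]; rewrite ?expr0 ?abs1 // !exprS (absM v_abs) IH. Qed.

Lemma absN x : v (- x) = v x.
Proof.
have vN1 : v (-1) = 1.
  apply/eqP; rewrite -(@eqrXn2 _ 2) ?(abs_ge0 v_abs) //.
  by rewrite -absX sqrrN !expr1n abs1.
by rewrite -mulN1r (absM v_abs) vN1 mul1r.
Qed.

Lemma abs_sign n x : v ((-1) ^+ n * x) = v x.
Proof. by rewrite (absM v_abs) absX absN abs1 expr1n mul1r. Qed.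

Lemma absV x : v x^-1 = (v x)^-1.
Proof.
have [->|x0] := eqVneq x 0; first by rewrite invr0 abs0 invr0.
by apply: (mulfI (abs_neq0 x0)); rewrite -(absM v_abs) !divff ?abs1 ?abs_neq0.
Qed.

Lemma abs_prod (I : Type) (r : seq I) (P : pred I) (F : I -> K) :
  v (\prod_(i <- r | P i) F i) = \prod_(i <- r | P i) v (F i).
Proof. by apply: big_morph; [exact: (absM v_abs) | exact: abs1]. Qed.

Lemma absD_le x y C : v x <= C -> v y <= C -> v (x + y) <= C.
Proof.
by move=> xC yC; apply: (le_trans (abs_ultra v_abs x y)); rewrite ge_max xC.
Qed.

Lemma absB_le x y C : v x <= C -> v y <= C -> v (x - y) <= C.
Proof. by move=> xC yC; apply: absD_le; rewrite ?absN. Qed.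

Lemma absBC x y : v (x - y) = v (y - x).
Proof. by rewrite -absN opprB. Qed.

Lemma abs_le_of_diff x y C : v (x - y) <= C -> v y <= C -> v x <= C.
Proof. by move=> xyC yC; rewrite -(subrK y x); apply: absD_le. Qed.

Lemma abs_sum_le (I : Type) (r : seq I) (P : pred I) (F : I -> K) C :
  0 <= C -> (forall i, P i -> v (F i) <= C) -> v (\sum_(i <- r | P i) F i) <= C.
Proof.
move=> C0 FC; apply: (big_ind (fun x => v x <= C)) => //; first by rewrite abs0.
by move=> *; exact: absD_le.
Qed.

Lemma absM_le x y C D : v x <= C -> v y <= D -> v (x * y) <= C * D.
Proof. by move=> xC yD; rewrite (absM v_abs) ler_pM ?(abs_ge0 v_abs). Qed.

Lemma abs_eq_of_lt x y : v (x - y) < v y -> v x = v y.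
Proof.
move=> xy; apply/eqP; rewrite eq_le (abs_le_of_diff (ltW xy)) //=.
rewrite leNgt; apply/negP => xy'.
have : v y <= Num.max (v (y - x)) (v x).
  by rewrite -{1}(subrK x y); exact: (abs_ultra v_abs).
by rewrite le_max absBC !leNgt xy xy'.
Qed.

Lemma abs_nat_le1 n : v n%:R <= 1.
Proof. by elim: n => [|n IH]; rewrite ?abs0 // -natr1 absD_le ?abs1. Qed.

Lemma abs_det_le n (A : 'M[K]_n) (r c : 'I_n -> R) :
  (forall i, 0 <= r i) -> (forall j, 0 <= c j) ->
  (forall i j, v (A i j) <= r i * c j) ->
  v (\det A) <= (\prod_i r i) * \prod_j c j.
Proof.
move=> r0 c0 Arc; rewrite /determinant; apply: abs_sum_le => [|s _].
  by rewrite mulr_ge0 // prodr_ge0.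
rewrite abs_sign abs_prod (reindex_inj (@perm_inj _ s) (F := c)) /= -big_split.
by apply: ler_prod => i _; rewrite (abs_ge0 v_abs) Arc.
Qed.

End Abs.

Section PadicAbs.
Variables (R : realType) (p : nat) (K : fieldType) (v : K -> R).
Hypotheses (p_prime : prime p) (v_abs : nonarchimedean_abs v).
Hypothesis v_nat : forall n, (0 < n)%N -> v n%:R = (p%:R ^+ logn p n)^-1.

Let p_gt0 : (0 : R) < p%:R. Proof. by rewrite ltr0n prime_gt0. Qed.

Lemma natr_neq0 n : (0 < n)%N -> n%:R != 0 :> K.
Proof.
move=> n0; apply/eqP => /(abs_eq0 v_abs); rewrite v_nat // => /eqP.
by rewrite invr_eq0 expf_eq0 gt_eqF // andbF.
Qed.

Lemma abs_p : v p%:R = p%:R^-1.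
Proof. by rewrite v_nat ?prime_gt0 // logn_prime // eqxx expr1. Qed.

Lemma abs_p_gt0 : 0 < v p%:R.
Proof. by rewrite abs_p invr_gt0. Qed.

Lemma abs_nat_unit n : ~~ (p %| n)%N -> v n%:R = 1.
Proof.
move=> pn; case: n pn => [|n] pn; first by rewrite dvdn0 in pn.
by rewrite v_nat // lognE (negPf pn) !andbF expr0 invr1.
Qed.

Lemma abs_nat_dvd n : (p %| n)%N -> v n%:R <= v p%:R.
Proof.
case/dvdnP => m ->; rewrite natrM (absM v_abs) ler_piMl ?(abs_ge0 v_abs) //.
exact: abs_nat_le1.
Qed.

Lemma abs_nat_mod m n : m = n %[mod p] -> v (m%:R - n%:R) <= v p%:R.
Proof.
move=> mn; rewrite (divn_eq m p) (divn_eq n p) mn !natrD !natrM.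
rewrite opprD addrACA subrr addr0 -mulrBl (absM v_abs).
rewrite ler_piMl ?(abs_ge0 v_abs) // absB_le // abs_nat_le1 //.
Qed.

(* [x ^+ p - x] is small on p-integral elements of the prime field only. *)
Lemma abs_fermat m n : (0 < n)%N -> v (m%:R / n%:R) <= 1 ->
  v ((m%:R / n%:R) ^+ p - m%:R / n%:R) <= v p%:R.
Proof.
move=> n0; have [->|m0] := posnP m.
  by rewrite mul0r expr0n gtn_eqF ?prime_gt0 // subr0 abs0 // (abs_ge0 v_abs).
move=> mn1; have {}mn1 : p%:R ^+ logn p n / p%:R ^+ logn p m <= 1 :> R.
  by move: mn1; rewrite (absM v_abs) (absV v_abs) !v_nat // invrK mulrC.
have lmn : (logn p n <= logn p m)%N.
  rewrite leqNgt; apply: contraTN mn1 => lt_mn; rewrite -ltNge.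
  rewrite ltr_pdivlMr ?exprn_gt0 // mul1r ltr_eXn2l // ltr1n prime_gt1 //.
have [n' pn' En] := pfactor_coprime p_prime n0.
have [m' pm' Em] := pfactor_coprime p_prime m0.
set a := logn p n in lmn En *; set b := logn p m in lmn Em *.
have pn'2 : ~~ (p %| n')%N by rewrite -prime_coprime.
have n'0 : (0 < n')%N by case: (n') pn'2; rewrite ?dvdn0.
have -> : m%:R / n%:R = (m' * p ^ (b - a))%:R / n'%:R :> K.
  apply/eqP; rewrite eqr_div ?natr_neq0 // -!natrM {1}Em {1}En.
  by rewrite -{1}(subnK lmn) expnD; apply/eqP; congr _%:R; ring.
move: (m' * _)%N => k.
have -> : (k%:R / n'%:R) ^+ p - k%:R / n'%:R
   = ((k ^ p * n')%:R - (k * n' ^ p)%:R) / n'%:R ^+ p.+1 :> K.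
  rewrite !natrM !natrX exprSr expr_div_n.
  have nz : n'%:R != 0 :> K by exact: natr_neq0.
  have nz' : n'%:R ^+ p != 0 :> K by exact: expf_neq0.
  move: nz nz'; move: (n'%:R ^+ p) (k%:R ^+ p) => y z nz nz'.
  by field; rewrite nz.
rewrite (absM v_abs) (absV v_abs) (absX v_abs) (abs_nat_unit pn'2) expr1n invr1 mulr1.
apply: abs_nat_mod.
by rewrite -modnMml fermat_little // modnMml -[in RHS]modnMmr fermat_little // modnMmr.
Qed.

End PadicAbs.

(** * Formal power series *)

Section Series.
Variable K : fieldType.
Implicit Types f g u w : nat -> K.

Definition pstheta f : nat -> K := fun n => n%:R * f n.

Lemma psmul_poly f g (P Q : {poly K}) n :
  (forall i, (i <= n)%N -> P`_i = f i) -> (forall i, (i <= n)%N -> Q`_i = g i) ->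
  psmul f g n = (P * Q)`_n.
Proof.
move=> fP gQ; rewrite coefM; apply: eq_bigr => i _.
by rewrite fP ?gQ ?leq_subr // -ltnS.
Qed.

Definition pstrunc n f : {poly K} := \poly_(i < n.+1) f i.

Lemma coef_pstrunc n f i : (i <= n)%N -> (pstrunc n f)`_i = f i.
Proof. by move=> i_n; rewrite coef_poly ltnS i_n. Qed.

Lemma psmul_trunc n f g i : (i <= n)%N ->
  psmul f g i = (pstrunc n f * pstrunc n g)`_i.
Proof.
by move=> i_n; apply: psmul_poly => j j_i; rewrite coef_pstrunc // (leq_trans j_i).
Qed.

Lemma psmulC f g : psmul f g = psmul g f.
Proof. by apply/funext => n; rewrite !(@psmul_trunc n) // mulrC. Qed.

Lemma psmulA f g u : psmul f (psmul g u) = psmul (psmul f g) u.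
Proof.
apply/funext => n.
rewrite (@psmul_poly _ _ (pstrunc n f) (pstrunc n g * pstrunc n u)); last first.
- by move=> i i_n; rewrite -psmul_trunc.
- by move=> i i_n; rewrite coef_pstrunc.
rewrite (@psmul_poly _ _ (pstrunc n f * pstrunc n g) (pstrunc n u)) ?mulrA //.
- by move=> i i_n; rewrite -psmul_trunc.
- by move=> i i_n; rewrite coef_pstrunc.
Qed.

Lemma psmul1s f : psmul (@psone K) f = f.
Proof.
apply/funext => n; rewrite /psmul big_ord_recl /= subn0 mul1r big1 ?addr0 // => i _.
by rewrite /psone mul0r.
Qed.

Lemma psmul0 f g : psmul f g 0%N = f 0%N * g 0%N.
Proof. by rewrite /psmul big_ord_recl big_ord0 addr0. Qed.

Lemma psmulZl c f g n : psmul (fun i => c * f i) g n = c * psmul f g n.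
Proof. by rewrite /psmul big_distrr; apply: eq_bigr => i _; rewrite /= mulrA. Qed.

Lemma psmulDl f g u n :
  psmul (fun i => f i + g i) u n = psmul f u n + psmul g u n.
Proof. by rewrite /psmul -big_split; apply: eq_bigr => i _; rewrite /= mulrDl. Qed.

Lemma pspow_poly f (P : {poly K}) n k :
  (forall i, (i <= n)%N -> P`_i = f i) ->
  forall i, (i <= n)%N -> (P ^+ k)`_i = pspow f k i.
Proof.
move=> fP; elim: k => [|k IH] i i_n; first by rewrite expr0 coef1.
rewrite exprS; symmetry; apply: psmul_poly => j j_i.
  by rewrite fP // (leq_trans j_i).
by rewrite IH // (leq_trans j_i).
Qed.

Lemma pspow_at0 f k : pspow f k 0%N = f 0%N ^+ k.
Proof. by elim: k => [|k IH] //; rewrite exprS -IH /pspow iterS psmul0. Qed.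

Lemma pspow_eq0 f k n : f 0%N = 0 -> (n < k)%N -> pspow f k n = 0.
Proof.
move=> f0; elim: k n => [//|k IH] n n_k; rewrite /pspow iterS /psmul.
rewrite big_ord_recl f0 mul0r add0r big1 // => i _.
rewrite -/(pspow f k) IH ?mulr0 //= /bump /=.
by have := ltn_ord i; lia.
Qed.

Lemma pstheta_mul f g :
  pstheta (psmul f g)
  = (fun n => psmul (pstheta f) g n + psmul f (pstheta g) n).
Proof.
apply/funext => n; rewrite /pstheta /psmul big_distrr -big_split.
apply: eq_bigr => i _ /=.
have -> : n%:R = i%:R + (n - i)%:R :> K by rewrite -natrD subnKC // -ltnS.
by ring.
Qed.

Lemma pstheta_pow f k :
  pstheta (pspow f k.+1) = (fun n => k.+1%:R * psmul (pstheta f) (pspow f k) n).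
Proof.
elim: k => [|k IH]; apply/funext => n.
  by rewrite /pspow /= psmulC psmul1s psmulC psmul1s mul1r.
rewrite -[pspow f k.+2]/(psmul f (pspow f k.+1)) pstheta_mul IH.
rewrite [psmul f (fun _ => _)]psmulC psmulZl -psmulA [psmul _ f]psmulC.
by rewrite -[psmul f (pspow f k)]/(pspow f k.+1) -[in RHS]natr1 mulrDl mul1r addrC.
Qed.

Hypothesis char0 : forall n, (0 < n)%N -> n%:R != 0 :> K.

Lemma psexp0 f : psexp f 0%N = 1.
Proof. by rewrite /psexp big_ord1 /= divr1. Qed.

Lemma psexp_widen f n m : f 0%N = 0 -> (n <= m)%N ->
  psexp f n = \sum_(k < m.+1) pspow f k n / k`!%:R.
Proof.
move=> f0 n_m; rewrite /psexp -!(big_mkord xpredT (fun k => pspow f k n / k`!%:R)).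
rewrite (@big_cat_nat _ _ _ n.+1 0 m.+1) //=.
rewrite [X in _ + X]big_nat_cond [X in _ + X]big1 ?addr0 // => k /andP[/andP[nk _] _].
by rewrite pspow_eq0 // mul0r.
Qed.

Lemma pstheta_exp f : f 0%N = 0 ->
  pstheta (psexp f) = psmul (pstheta f) (psexp f).
Proof.
move=> f0; apply/funext => n.
transitivity (\sum_(k < n) psmul (pstheta f) (pspow f k) n / k`!%:R).
  rewrite /pstheta /psexp big_ord_recl mulrDr big_distrr.
  rewrite [X in X + _](_ : _ = 0); last first.
    by rewrite /pspow /= /psone; case: n => [|n]; rewrite ?mul0r ?mulr0.
  rewrite add0r; apply: eq_bigr => k _.
  have := congr1 (fun u => u n) (pstheta_pow f k); rewrite /pstheta /= => {}E.
  rewrite /bump /= add1n mulrA E factS natrM.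
  have k0 : k.+1%:R != 0 :> K by exact: char0.
  have k1 : k`!%:R != 0 :> K by rewrite char0 ?fact_gt0.
  move: k0 k1; move: (k.+1%:R) (k`!%:R) (psmul _ _ _) => a b c a0 b0.
  by field; rewrite ?a0 ?b0.
transitivity
  (\sum_(k < n) \sum_(i < n.+1) pstheta f i * pspow f k (n - i)%N / k`!%:R).
  by apply: eq_bigr => k _; rewrite mulr_suml.
rewrite exchange_big /=.
apply: eq_bigr => -[[|i] i_n] _ /=.
  rewrite /pstheta mul0r mul0r big1 // => k _; by rewrite !mul0r.
have n0 : (0 < n)%N by case: (n) i_n.
rewrite (@psexp_widen _ _ n.-1) ?big_distrr ?prednK //=; last by lia.
by apply: eq_bigr => k _; rewrite /= mulrA.
Qed.

Lemma psode_unique c u w : c 0%N = 0 -> u 0%N = w 0%N ->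
  pstheta u = psmul c u -> pstheta w = psmul c w -> u = w.
Proof.
move=> c0 uw0 uE wE; apply/funext => n; elim/ltn_ind: n => -[//|n] IH.
apply: (mulfI (char0 (ltn0Sn n))).
have := congr1 (fun u => u n.+1) uE; have := congr1 (fun u => u n.+1) wE.
rewrite /pstheta => -> ->; rewrite /psmul !(big_ord_recl n.+1) c0 !mul0r !add0r.
by apply: eq_bigr => i _; rewrite /= IH // /bump /=; have := ltn_ord i; lia.
Qed.

Lemma pspow_scale c f k : pspow (psscale c f) k = psscale c (pspow f k).
Proof.
elim: k => [|k IH]; apply/funext => n.
  by rewrite /psscale /pspow /= /psone; case: n => [|n]; rewrite ?mulr1 ?mulr0.
rewrite /pspow !iterS -!/(pspow _ k) IH /psscale /psmul big_distrr.
apply: eq_bigr => i _; rewrite /= mulrACA -exprD subnKC //.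
by rewrite -ltnS.
Qed.

Lemma psexp_scale c f n : psexp (psscale c f) n = c ^+ n * psexp f n.
Proof.
rewrite /psexp big_distrr; apply: eq_bigr => k _.
by rewrite /= pspow_scale /psscale mulrA.
Qed.

Lemma psTpow_mul m f g : (0 < m)%N ->
  psTpow m (psmul f g) = psmul (psTpow m f) (psTpow m g).
Proof.
move=> m0; apply/funext => n.
have agree u i : (i <= n)%N -> (pstrunc n u \Po 'X^m)`_i = psTpow m u i.
  move=> i_n; rewrite coef_comp_poly_Xn // /psTpow; case: ifP => // _.
  by rewrite coef_pstrunc // (leq_trans (leq_div _ _)).
rewrite (@psmul_poly _ _ _ _ n (agree f) (agree g)) -comp_polyM.
rewrite coef_comp_poly_Xn // /psTpow; case: ifP => // _.
by rewrite (@psmul_trunc n) // leq_div.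
Qed.

Lemma pstheta_Tpow m f : (0 < m)%N ->
  pstheta (psTpow m f) = fun n => m%:R * psTpow m (pstheta f) n.
Proof.
move=> m0; apply/funext => n; rewrite /pstheta /psTpow.
case: ifP => [mn|_]; last by rewrite !mulr0.
by rewrite -{1}(divnK mn) natrM mulrCA mulrA.
Qed.

End Series.

(** * The Artin-Hasse exponential *)

Section IntegralPoly.
Variables (R : realType) (K : fieldType) (v : K -> R).
Hypothesis v_abs : nonarchimedean_abs v.
Implicit Types (P Q : {poly K}) (C D : R).

Definition coef_le C P := forall i, v P`_i <= C.

Lemma coef_leD C P Q : coef_le C P -> coef_le C Q -> coef_le C (P + Q).
Proof. by move=> PC QC i; rewrite coefD (absD_le v_abs). Qed.

Lemma coef_leM C D P Q :
  coef_le C P -> coef_le D Q -> coef_le (C * D) (P * Q).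
Proof.
move=> PC QD i; rewrite coefM (abs_sum_le v_abs) ?mulr_ge0 //.
- exact: le_trans (abs_ge0 v_abs _) (PC 0%N).
- exact: le_trans (abs_ge0 v_abs _) (QD 0%N).
- by move=> j _; exact: (absM_le v_abs).
Qed.

Lemma coef_le1X P k : coef_le 1 P -> coef_le 1 (P ^+ k).
Proof.
move=> P1; elim: k => [i|k IH]; last by rewrite exprS -(mulr1 1); exact: coef_leM.
by rewrite expr0 coef1 (abs_nat_le1 v_abs).
Qed.

Lemma coef_leC C c : v c <= C -> coef_le C c%:P.
Proof.
move=> cC i; rewrite coefC; case: ifP => // _; rewrite (abs0 v_abs).
exact: le_trans (abs_ge0 v_abs c) cC.
Qed.

Lemma coef_le1MXn P k : coef_le 1 P -> coef_le 1 (P * 'X^k).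
Proof.
move=> P1 i; rewrite coefMXn; case: ifP => // _.
by rewrite (abs0 v_abs).
Qed.

End IntegralPoly.

Section ArtinHasse.
Variables (R : realType) (p : nat) (K : fieldType) (v : K -> R).
Hypotheses (p_prime : prime p) (v_abs : nonarchimedean_abs v).
Hypothesis v_nat : forall n, (0 < n)%N -> v n%:R = (p%:R ^+ logn p n)^-1.

Let char0 : forall n, (0 < n)%N -> n%:R != 0 :> K := natr_neq0 p_prime v_abs v_nat.

Lemma exprD_middle (A : comPzRingType) (x y : A) n :
  (x + y) ^+ n.+1 - x ^+ n.+1 - y ^+ n.+1
  = \sum_(i < n) (x ^+ (n - i) * y ^+ i.+1) *+ 'C(n.+1, i.+1).
Proof.
rewrite exprDn big_ord_recl big_ord_recr /= /bump /= !add1n subn0 subnn bin0 binn.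
rewrite !expr0 mulr1 mul1r !mulr1n [x ^+ _ + (_ + _)]addrC !addrK.
by apply: eq_bigr => i _; rewrite add1n subSS.
Qed.

Lemma coef_le_frobeniusD (P Q : {poly K}) : coef_le v 1 P -> coef_le v 1 Q ->
  coef_le v (v p%:R) ((P + Q) ^+ p - P ^+ p - Q ^+ p).
Proof.
move=> P1 Q1 j; have p0 := prime_gt0 p_prime.
rewrite -(prednK p0) exprD_middle prednK //.
rewrite coef_sum (abs_sum_le v_abs) ?(abs_ge0 v_abs) // => i _.
rewrite coefMn -[_ *+ binomial _ _]mulr_natl -[leRHS]mulr1 (absM_le v_abs) //.
  by rewrite (abs_nat_dvd v_abs) // prime_dvd_bin //=; have := ltn_ord i; lia.
by rewrite -(mulr1 1); apply: coef_leM => //; apply: coef_le1X.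
Qed.

Lemma coef_le_frobenius (P : {poly K}) : coef_le v 1 P ->
  (forall i, v (P`_i ^+ p - P`_i) <= v p%:R) ->
  coef_le v (v p%:R) (P ^+ p - (P \Po 'X^p)).
Proof.
elim/poly_ind: P => [|P c IH] P1 PF.
  move=> i; rewrite comp_poly0 expr0n gtn_eqF ?prime_gt0 // subr0 coef0.
  by rewrite (abs0 v_abs) (abs_ge0 v_abs).
have coefS i : (P * 'X + c%:P)`_i.+1 = P`_i by rewrite coefD coefMX coefC addr0.
have coef0 : (P * 'X + c%:P)`_0 = c by rewrite coefD coefMX coefC add0r.
have {}IH : coef_le v (v p%:R) (P ^+ p - (P \Po 'X^p)).
  by apply: IH => i; rewrite -coefS.
have c1 : coef_le v 1 c%:P by apply: (coef_leC v_abs); rewrite -coef0.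
have PX1 : coef_le v 1 (P * 'X).
  by rewrite -['X]expr1; apply: coef_le1MXn => // i; rewrite -coefS.
rewrite comp_polyD comp_polyM comp_polyX comp_polyC.
rewrite (_ : _ - _ = ((P * 'X + c%:P) ^+ p - (P * 'X) ^+ p - c%:P ^+ p)
  + ((P ^+ p - (P \Po 'X^p)) * 'X^p + (c ^+ p - c)%:P)).
  apply: coef_leD => //; first exact: coef_le_frobeniusD.
  apply: coef_leD => //; last by apply: (coef_leC v_abs); have := PF 0%N; rewrite coef0.
  move=> i; rewrite coefMXn; case: ifP => [_|_]; last exact: IH.
  by rewrite (abs0 v_abs) (abs_ge0 v_abs).
rewrite exprMn polyCB rmorphXn /=; ring.
Qed.

Lemma exprD_mod_sqr (A : comPzRingType) (x y : A) k :
  exists z, (x + y) ^+ k.+1 = x ^+ k.+1 + k.+1%:R * x ^+ k * y + y ^+ 2 * z.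
Proof.
elim: k => [|k [z E]]; first by exists 0; rewrite expr0 !expr1; ring.
exists (k.+1%:R * x ^+ k + x * z + y * z).
by rewrite exprS E -[k.+2%:R]natr1 !(exprS x k.+1) !(exprS x k); ring.
Qed.

Lemma coefn_exprDXn (P : {poly K}) c n k : P`_0 = 1 -> (0 < n)%N ->
  ((P + c%:P * 'X^n) ^+ k.+1)`_n = (P ^+ k.+1)`_n + k.+1%:R * c.
Proof.
move=> P0 n0; have [z ->] := exprD_mod_sqr P (c%:P * 'X^n) k.
have Pk0 : (P ^+ k)`_0 = 1.
  by elim: (k) => [|j IH]; rewrite ?coef1 // exprS coef0M P0 IH mulr1.
have -> : (c%:P * 'X^n) ^+ 2 * z = c%:P ^+ 2 * z * 'X^(n * 2) by rewrite exprM; ring.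
rewrite !coefD [X in _ + X]coefMXn ifT ?addr0; last by lia.
by rewrite mulrA coefMXn ltnn subnn !coef0M Pk0 coefC mulr1 -polyC_natr coefC.
Qed.

Definition artin_hasse : nat -> K := psexp (lseries K p).

Lemma hseriesE pi n : hseries p pi n = pi ^+ n * artin_hasse n.
Proof. exact: psexp_scale. Qed.

Lemma lseries0 : lseries K p 0%N = 0.
Proof.
by rewrite /lseries big1 // => i /eqP; rewrite ord1 expn0.
Qed.

Lemma pstheta_lseries : pstheta (lseries K p) = fun n => (p.-nat n)%:R.
Proof.
apply/funext => n; rewrite /pstheta /lseries; have [/p_natP[e ->]|pn] := boolP (p.-nat n).
  have e_lt : (e < (p ^ e).+1)%N by rewrite ltnS ltnW // ltn_expl // prime_gt1.
  rewrite (big_pred1 (Ordinal e_lt)) => [|i] /=; last first.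
    by rewrite eqn_exp2l // prime_gt1.
  by rewrite natrX divff // expf_neq0 // char0 // prime_gt0.
rewrite big_pred0 ?mulr0 // => i; apply: contraNF pn => /eqP <-.
by rewrite pnatX pnat_id.
Qed.

Lemma artin_hasse0 : artin_hasse 0%N = 1.
Proof. exact: psexp0. Qed.

Lemma pstheta_artin_hasse :
  pstheta artin_hasse = psmul (fun n => (p.-nat n)%:R) artin_hasse.
Proof. by rewrite pstheta_exp ?pstheta_lseries // lseries0. Qed.

Lemma artin_hasse_rec n :
  n.+1%:R * artin_hasse n.+1
  = \sum_(i < n.+1) (p.-nat i.+1)%:R * artin_hasse (n - i)%N.
Proof.
have := congr1 (fun u => u n.+1) pstheta_artin_hasse; rewrite {1}/pstheta => ->.
by rewrite /psmul big_ord_recl mul0r add0r.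
Qed.

Lemma artin_hasse_small n : (n < p)%N -> artin_hasse n = n`!%:R^-1.
Proof.
elim: n => [|n IH] n_p; first by rewrite artin_hasse0 invr1.
apply: (mulfI (char0 (ltn0Sn n))); rewrite artin_hasse_rec big_ord_recl subn0.
rewrite (_ : p.-nat _ = true) // mul1r IH ?(ltnW n_p) // big1 ?addr0 => [|i _].
  by rewrite factS natrM invfM mulrA divff ?char0 // mul1r.
rewrite (_ : p.-nat _ = false) ?mul0r //; apply/negP => /p_natP[[|e]] //.
have : (p <= p ^ e.+1)%N by rewrite expnS leq_pmulr // expn_gt0 prime_gt0.
move=> /[swap] <-; rewrite /= /bump /=; have := ltn_ord i; lia.
Qed.

Lemma artin_hasse_rational n :
  exists a b : nat, (0 < b)%N /\ artin_hasse n = a%:R / b%:R.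
Proof.
pose rational x := exists a b : nat, (0 < b)%N /\ x = a%:R / b%:R :> K.
rewrite -/(rational _); elim/ltn_ind: n => -[_|n IH].
  by exists 1%N, 1%N; rewrite artin_hasse0 divr1.
have [a [b [b0 E]]] : rational (n.+1%:R * artin_hasse n.+1).
  rewrite artin_hasse_rec; apply: (big_ind rational).
  - by exists 0%N, 1%N; rewrite mul0r.
  - move=> _ _ [a [b [b0 ->]]] [c [d [d0 ->]]].
    exists (a * d + c * b)%N, (b * d)%N; rewrite muln_gt0 b0 d0; split=> //.
    by rewrite addf_div ?char0 // natrD !natrM.
  - move=> i _; have [|a [b [b0 ->]]] := IH (n - i)%N; first by lia.
    by exists (p.-nat i.+1 * a)%N, b; rewrite natrM mulrA.
exists a, (n.+1 * b)%N; rewrite muln_gt0 b0; split=> //.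
apply: (mulfI (char0 (ltn0Sn n))); rewrite E natrM invfM mulrCA.
by rewrite mulVKf ?char0.
Qed.

Lemma sum_divn_lt N m : (0 < m)%N -> (\sum_(1 <= k < N) m %/ p ^ k < m)%N.
Proof.
elim: N m => [|N IH] m m0; first by rewrite big_geq.
case: N IH => [|N] IH; first by rewrite big_geq.
rewrite big_nat_recl // big_add1 /=.
have -> : (\sum_(0 <= i < N) m %/ p ^ i.+2 = \sum_(1 <= k < N.+1) (m %/ p) %/ p ^ k)%N.
  by rewrite big_add1 /=; apply: eq_bigr => i _; rewrite -divnMA -expnS.
rewrite expn1; have [q0|q0] := posnP (m %/ p).
  by rewrite q0 big1 // => i _; rewrite div0n.
have := IH _ q0; have : (2 * (m %/ p) <= m)%N; last by lia.
apply: leq_trans (leq_trunc_div m p); rewrite mulnC leq_mul2l.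
by rewrite prime_gt1 // orbT.
Qed.

Lemma abs_exp_coef n : (0 < n)%N -> v (p%:R ^+ n / n`!%:R) <= v p%:R.
Proof.
move=> n0; rewrite (absM v_abs) (absV v_abs) (absX v_abs) (v_nat (fact_gt0 n)) invrK.
rewrite (abs_p p_prime v_nat).
have lt_n : (logn p n`! < n)%N by rewrite logn_fact // sum_divn_lt.
move: (logn p n`!) lt_n => L lt_n.
have p0 : (0 : R) < p%:R by rewrite ltr0n prime_gt0.
rewrite exprVn -{1}(subnK (ltnW lt_n)) exprD invfM -mulrA mulVf ?mulr1; last first.
  by rewrite expf_neq0 // gt_eqF.
rewrite -subn_gt0 in lt_n; rewrite lef_pV2 ?posrE ?exprn_gt0 //.
by rewrite -(prednK lt_n) exprS ler_pMr // exprn_ege1 // ler1n prime_gt0.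
Qed.

(* The logarithms agree, since [p l(T) = p T + l(T^p)]. *)
Lemma artin_hasse_pow :
  pspow artin_hasse p
  = psmul (psTpow p artin_hasse) (fun n => p%:R ^+ n / n`!%:R).
Proof.
have p0 := prime_gt0 p_prime.
set F := artin_hasse; set lam : nat -> K := fun n => (p.-nat n)%:R.
set E := fun n => _.
have thE : pstheta E = psmul (fun n => p%:R * (n == 1%N)%:R) E.
  apply/funext => -[|n]; first by rewrite psmul0 mulr0 mul0r /pstheta mul0r.
  rewrite psmulZl /psmul big_ord_recl mul0r add0r big_ord_recl big1 => [|i _].
    rewrite addr0 mul1r /pstheta /bump /= subSS subn0 /E factS natrM exprS.
    have := char0 (ltn0Sn n); have : n`!%:R != 0 :> K by rewrite char0 ?fact_gt0.
    move: (n.+1%:R : K) (n`!%:R : K) (p%:R ^+ n : K) (p%:R : K) => a b c d b0 a0.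
    by field; rewrite ?a0 ?b0.
  by rewrite mul0r.
apply: (psode_unique char0 (c := fun n => p%:R * lam n)).
- by rewrite mulr0.
- by rewrite pspow_at0 psmul0 /psTpow dvdn0 div0n /E /F artin_hasse0 expr1n expr0 divr1 mul1r.
- apply/funext => n; rewrite psmulZl -{1 2}(prednK p0) pstheta_pow.
  rewrite (prednK p0) pstheta_artin_hasse -psmulA -/F.
  by rewrite -[psmul F (pspow F p.-1)]/(pspow F p.-1.+1) prednK.
apply/funext => n; rewrite pstheta_mul thE pstheta_Tpow // pstheta_artin_hasse.
rewrite psTpow_mul // -/lam -/F psmulZl -psmulA.
rewrite [psmul (psTpow p F) (psmul _ _)]psmulC -psmulA.
rewrite [psmul E _]psmulC !psmulZl -mulrDr -psmulDl; congr (_ * psmul _ _ _).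
apply/funext => m; rewrite /lam /psTpow; case: ifP => [/dvdnP[j ->]|pm].
  rewrite mulnK // pnatM pnat_id // andbT muln_eq1 (gtn_eqF (prime_gt1 p_prime)).
  by rewrite andbF addr0.
rewrite add0r; congr ((nat_of_bool _)%:R); case: eqVneq => [->|m1]; first by [].
symmetry; apply: negbTE; apply: contraFN pm => /p_natP[[|e] Em].
  by rewrite Em eqxx in m1.
by rewrite Em expnS dvdn_mulr.
Qed.

(* Dwork's argument: in degree n, [F^p = F(T^p) e^(pT)] reads
   [p a_n = 0] modulo [p], the lower coefficients being Frobenius-invariant. *)
Lemma abs_artin_hasse_le1 n : v (artin_hasse n) <= 1.
Proof.
set F := artin_hasse; elim/ltn_ind: n => n IH; have [n0|n0] := posnP n.
  by rewrite n0 /F artin_hasse0 (abs1 v_abs).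
pose G : {poly K} := \poly_(i < n) F i.
have GF i : (i < n)%N -> G`_i = F i by move=> i_n; rewrite coef_poly i_n.
have G0 : G`_0 = 1 by rewrite GF // /F artin_hasse0.
have G1 : coef_le v 1 G.
  move=> i; rewrite coef_poly; case: ifP => [/IH //|_].
  by rewrite (abs0 v_abs).
have GE i : (i <= n)%N -> (G + (F n)%:P * 'X^n)`_i = F i.
  rewrite leq_eqVlt coefD coefMXn => /orP[/eqP->|i_n].
    by rewrite ltnn subnn coefC coef_poly ltnn add0r.
  by rewrite i_n addr0 GF.
have Fp : pspow F p n = (G ^+ p)`_n + p%:R * F n.
  rewrite -(pspow_poly p GE (leqnn n)).
  by have := coefn_exprDXn (F n) p.-1 G0 n0; rewrite prednK ?prime_gt0.
have pF : v (psTpow p F n - (G ^+ p)`_n) <= v p%:R.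
  rewrite (_ : psTpow p F n = (G \Po 'X^p)`_n).
    rewrite (absBC v_abs) -coefB; apply: coef_le_frobenius => // i.
    rewrite coef_poly; case: ifP => [i_n|_].
      have := IH i i_n; rewrite /F; have [a [b [b0 ->]]] := artin_hasse_rational i.
      exact: (abs_fermat p_prime v_abs v_nat).
    rewrite expr0n gtn_eqF ?prime_gt0 // subr0 (abs0 v_abs).
    exact: (abs_ge0 v_abs).
  rewrite /psTpow coef_comp_poly_Xn ?prime_gt0 //; case: ifP => // _.
  by rewrite GF // ltn_Pdiv // prime_gt1.
have pE : v (pspow F p n - psTpow p F n) <= v p%:R.
  rewrite artin_hasse_pow -/F /psmul big_ord_recr /= subnn expr0 divr1 mulr1 addrK.
  apply: (abs_sum_le v_abs) => [|i _]; first exact: (abs_ge0 v_abs).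
  rewrite -[X in _ <= X]mul1r (absM_le v_abs) //.
    rewrite /psTpow; case: ifP => [_|_]; last by rewrite (abs0 v_abs).
    by rewrite IH // (leq_ltn_trans (leq_div _ _)).
  by rewrite abs_exp_coef // subn_gt0.
have : v (p%:R * F n) <= v p%:R.
  rewrite (_ : p%:R * F n = (pspow F p n - psTpow p F n)
     + (psTpow p F n - (G ^+ p)`_n)); last by rewrite Fp; ring.
  exact: (absD_le v_abs).
by rewrite (absM v_abs) ger_pMr // (abs_p_gt0 p_prime v_nat).
Qed.

Lemma abs_hseries_le pi n : v (hseries p pi n) <= v pi ^+ n.
Proof.
rewrite hseriesE (absM v_abs) (absX v_abs) ler_piMr ?exprn_ge0 ?(abs_ge0 v_abs) //.
exact: abs_artin_hasse_le1.
Qed.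

End ArtinHasse.

(** * Schur functions of truncated exponentials *)

Section Partitions.
Implicit Types kappa : int_partition.

Lemma plengthP kappa i : (kappa i == 0%N) = (plength kappa <= i)%N.
Proof.
have ex0 : exists n, kappa n == 0%N.
  by have [N kN] := part_eventually0 kappa; exists N; rewrite kN.
have [n /eqP kn n_min] := find_ex_minn ex0.
have nz j : (kappa j == 0%N) = (n <= j)%N.
  apply/eqP/idP => [kj|n_j]; first by apply: n_min; rewrite kj.
  by apply/eqP; rewrite -leqn0 -kn; apply: part_noninc.
have suppE : [set j : nat | kappa j <> 0%N] = `I_n.
  by apply/seteqP; split=> j /=; [move/eqP | move=> jn; apply/eqP]; rewrite nz -ltnNge.
by rewrite nz /plength suppE (card_fset_set (card_eqxx _)).
Qed.

Lemma pweightE kappa : pweight kappa = (\sum_(i < plength kappa) kappa i)%N.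
Proof.
rewrite fsbig_ord /pweight; symmetry; apply: fsbig_widen => // i [_ /= /negP].
by rewrite -leqNgt -plengthP => /eqP.
Qed.

End Partitions.

Section Determinants.

Lemma det_scale (A : comPzRingType) n (M : 'M[A]_n) (r c : 'I_n -> A) :
  \det (\matrix_(i, j) (r i * M i j * c j)) = (\prod_i r i) * (\prod_j c j) * \det M.
Proof.
have -> : \matrix_(i, j) (r i * M i j * c j)
    = diag_mx (\row_i r i) *m M *m diag_mx (\row_j c j).
  by rewrite mul_diag_mx mul_mx_diag; apply/matrixP => i j; rewrite !mxE.
rewrite !det_mulmx !det_diag mulrAC; congr (_ * _ * _).
  by apply: eq_bigr => i _; rewrite mxE.
by apply: eq_bigr => i _; rewrite mxE.
Qed.

Lemma det_monic_polys (A : comNzRingType) n (P : nat -> {poly A}) (x : 'rV[A]_n) :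
  (forall j, P j \is monic) -> (forall j, size (P j) = j.+1) ->
  \det (\matrix_(i < n, j < n) (P j).[x 0 i]) = \det (Vandermonde n x).
Proof.
move=> monP szP.
have -> : \matrix_(i < n, j < n) (P j).[x 0 i]
    = (Vandermonde n x)^T *m \matrix_(k < n, j < n) (P j)`_k.
  apply/matrixP => i j; rewrite !mxE (@horner_coef_wide _ n) ?szP //.
  by apply: eq_bigr => k _; rewrite !mxE mulrC.
suff U1 : \det (\matrix_(k < n, j < n) (P j)`_k) = 1 by rewrite det_mulmx det_tr U1 mulr1.
rewrite -det_tr det_trig ?big1 // => [i _|].
  by rewrite !mxE; have /eqP := monP i; rewrite /lead_coef szP.
by apply/is_trig_mxP => i j ij; rewrite !mxE nth_default // szP.
Qed.

Lemma det_ffact (A : comNzRingType) n (L : 'I_n -> nat) :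
  \det (\matrix_(i < n, j < n) (L i ^_ j)%:R : 'M[A]_n)
  = \prod_(i < n) \prod_(j < n | (i < j)%N) ((L j)%:R - (L i)%:R).
Proof.
pose P j : {poly A} := \prod_(0 <= k < j) ('X - (k%:R)%:P).
have -> : \matrix_(i < n, j < n) (L i ^_ j)%:R
    = \matrix_(i < n, j < n) (P j).[(\row_i (L i)%:R) 0 i] :> 'M[A]_n.
  apply/matrixP => i j; rewrite !mxE /P horner_prod.
  elim: (nat_of_ord j) => [|k IH]; first by rewrite big_geq.
  rewrite big_nat_recr // ffactnSr natrM IH /= hornerXsubC -IH.
  have [kL|Lk] := leqP k (L i); first by rewrite natrB.
  by rewrite ffact_small // !mul0r.
rewrite det_monic_polys ?det_Vandermonde.
- by apply: eq_bigr => i _; apply: eq_bigr => j _; rewrite !mxE.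
- by move=> j; apply: monic_prod_XsubC.
- by move=> j; rewrite size_prod_XsubC size_iota subn0.
Qed.

End Determinants.

Section SchurUnit.
Variables (R : realType) (p : nat) (K : fieldType) (v : K -> R).
Hypotheses (p_prime : prime p) (v_abs : nonarchimedean_abs v).
Hypothesis v_nat : forall n, (0 < n)%N -> v n%:R = (p%:R ^+ logn p n)^-1.

Lemma abs_nat_small n : (0 < n < p)%N -> v n%:R = 1.
Proof.
case/andP=> n0 n_p; apply: (abs_nat_unit v_nat).
by apply/negP => /(dvdn_leq n0); rewrite leqNgt n_p.
Qed.

Lemma abs_fact_small n : (n < p)%N -> v n`!%:R = 1.
Proof.
elim: n => [|n IH] n_p; first by rewrite fact0 (abs1 v_abs).
by rewrite factS natrM (absM v_abs) IH ?abs_nat_small ?mul1r // ltnW.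
Qed.

Lemma abs_det_ffact n (L : 'I_n -> nat) :
  (forall i, (L i < p)%N) -> (forall i j : 'I_n, (i < j)%N -> (L j < L i)%N) ->
  v (\det (\matrix_(i < n, j < n) (L i ^_ j)%:R)) = 1.
Proof.
move=> Lp Ldec; rewrite det_ffact (abs_prod v_abs) big1 // => i _.
rewrite (abs_prod v_abs) big1 // => j ij.
have lt_ji := Ldec i j ij; rewrite (absBC v_abs) -natrB ?(ltnW lt_ji) // abs_nat_small //.
by rewrite subn_gt0 lt_ji /= (leq_ltn_trans (leq_subr _ _)).
Qed.

Lemma abs_schur_hseries (pi : K) (kappa : int_partition) :
  pi != 0 -> (kappa 0%N + plength kappa <= p)%N ->
  v (schur kappa (of_ps (hseries p pi))) = v pi ^+ pweight kappa.
Proof.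
move=> pi0 kp; set l := plength kappa in kp *.
pose L (i : 'I_l) := (kappa i + (l - i.+1))%N.
have Lp i : (L i < p)%N.
  rewrite /L; have := part_noninc kappa (leq0n i); have := ltn_ord i; lia.
have Ldec (i j : 'I_l) : (i < j)%N -> (L j < L i)%N.
  rewrite /L => ij; have := part_noninc kappa (ltnW ij); have := ltn_ord j; lia.
pose F : 'M[K]_l := \matrix_(i, j) (L i ^_ j)%:R.
pose C : 'M[K]_l := \matrix_(i, j) ((L i)`!%:R^-1 * (L i ^_ (rev_ord j))%:R * 1).
have vC : v (\det C) = 1.
  have -> : C = \matrix_(i, j) ((L i)`!%:R^-1 * col_perm (perm rev_ord_inj) F i j * 1).
    by apply/matrixP => i j; rewrite !mxE permE.
  rewrite det_scale col_permE det_mulmx det_perm !(absM v_abs) (absX v_abs).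
  rewrite (absN v_abs) (abs1 v_abs) expr1n !(abs_prod v_abs).
  rewrite abs_det_ffact // [X in _ * X * _]big1 ?big1 ?mulr1 // => i _.
    by rewrite (absV v_abs) abs_fact_small ?invr1.
  exact: (abs1 v_abs).
rewrite /schur -/l; set S := (X in \det X).
have ES : \det (\matrix_(i < l, j < l) (pi ^+ i * S i j * 1))
       = \det (\matrix_(i < l, j < l) (pi ^+ kappa i * C i j * pi ^+ j)).
  congr (\det _); apply/matrixP => i j; rewrite !mxE !mulr1.
  have il := ltn_ord i; have jl := ltn_ord j.
  have [ij|ji] := leqP i (kappa i + j)%N; last first.
    rewrite ffact_small /=; last by rewrite /L; lia.
    rewrite mulr0 mulr0 mul0r; case E : (_ - _ + _) => [m|m] /=; last by rewrite mulr0.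
    by exfalso; lia.
  have -> : (kappa i)%:Z - i%:Z + j%:Z = (kappa i + j - i)%N :> int by lia.
  rewrite /= hseriesE (artin_hasse_small p_prime v_abs v_nat); last by have := Lp i; rewrite /L; lia.
  rewrite mulrA -exprD subnKC // exprD -mulrA [RHS]mulrAC -mulrA; congr (_ * (_ * _)).
  have -> : (kappa i + j - i)%N = (L i - (l - j.+1))%N by rewrite /L; lia.
  have le_L : (l - j.+1 <= L i)%N by rewrite /L; lia.
  have nz m : m`!%:R != 0 :> K by rewrite (natr_neq0 p_prime v_abs v_nat) ?fact_gt0.
  apply: (mulfI (nz (L i))); rewrite mulVKf //.
  by rewrite -[in LHS](ffact_fact le_L) natrM mulfK.
have := congr1 v ES; rewrite !det_scale !(absM v_abs) vC mulr1 (big1 _ _ (fun _ => 1)) //.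
rewrite (abs1 v_abs) mulr1 mulrC => /(mulIf _) ->.
  rewrite (abs_prod v_abs) pweightE -/l -prodrXr.
  by apply: eq_bigr => i _; rewrite (absX v_abs).
rewrite (abs_prod v_abs); apply/prodf_neq0 => i _.
by rewrite (absX v_abs) expf_neq0 // (abs_neq0 v_abs).
Qed.

End SchurUnit.

(** * Loops *)

Section Loops.
Variables (R : realType) (K : fieldType) (v : K -> R).
Hypothesis v_abs : nonarchimedean_abs v.
Implicit Types (f g : nat -> K) (rho : R).

Lemma abs_psmul_le rho f g : 0 <= rho ->
  (forall n, v (f n) <= rho ^+ n) -> (forall n, v (g n) <= rho ^+ n) ->
  forall n, v (psmul f g n) <= rho ^+ n.
Proof.
move=> rho0 fle gle n; apply: (abs_sum_le v_abs) => [|i _]; first exact: exprn_ge0.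
by rewrite -[in leRHS](@subnKC i n) ?exprD ?(absM_le v_abs) // -ltnS.
Qed.

Lemma abs_psTpow_le rho m f : 0 <= rho ->
  (forall n, v (f n) <= (rho ^+ m) ^+ n) -> forall n, v (psTpow m f n) <= rho ^+ n.
Proof.
move=> rho0 fle n; rewrite /psTpow; case: ifP => [/divnK {2}<-|_].
  by rewrite mulnC exprM.
by rewrite (abs0 v_abs) exprn_ge0.
Qed.

Lemma abs_psprod_linear (I : Type) (r : seq I) (F : I -> nat -> K) (c : R) n :
  0 <= c <= 1 -> (forall i, F i 0%N = 1) ->
  (forall i m, (0 < m)%N -> v (F i m) <= c) -> (0 < n)%N ->
  v ((\big[@psmul K/@psone K]_(i <- r) F i) n - \sum_(i <- r) F i n) <= c ^+ 2.
Proof.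
move=> /andP[c0 c1] F0 Fc n0.
pose P f s := [/\ f 0%N = 1, forall m, (0 < m)%N -> v (f m) <= c &
                 v (f n - s) <= c ^+ 2].
suff [] : P (\big[@psmul K/@psone K]_(i <- r) F i) (\sum_(i <- r) F i n) by [].
apply: (big_rec2 P) => [|i f s _ [f0 fc fs]].
  have one0 m : (0 < m)%N -> psone K m = 0 by case: m.
  split=> // [m m0|]; first by rewrite one0 // (abs0 v_abs).
  by rewrite one0 // subrr (abs0 v_abs) exprn_ge0.
have split_psmul m : (0 < m)%N ->
    exists2 e, v e <= c ^+ 2 & psmul (F i) f m = F i m + f m + e.
  case: m => // m _; exists (\sum_(j < m) F i j.+1 * f (m - j)%N).
    apply: (abs_sum_le v_abs) => [|j _]; first exact: exprn_ge0.
    by rewrite expr2 (absM_le v_abs) ?Fc ?fc // subn_gt0.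
  rewrite /psmul big_ord_recl big_ord_recr /= F0 subn0 mul1r /bump /= add1n.
  rewrite subnn f0 mulr1 [_ + F i _]addrC addrCA addrA; congr (_ + _).
split=> [|m m0|]; first by rewrite psmul0 F0 f0 mulr1.
  have [e ec ->] := split_psmul m m0; rewrite !(absD_le v_abs) ?Fc ?fc //.
  by rewrite (le_trans ec) // expr2 ler_piMl.
have [e ec ->] := split_psmul n n0.
have -> : F i n + f n + e - (F i n + s) = (f n - s) + e by ring.
exact: (absD_le v_abs).
Qed.

Lemma Gamma_of_ps rho f : 0 <= rho < 1 -> f 0%N = 1 ->
  (forall n, v (f n) <= rho ^+ n) ->
  Gamma_plus v (of_ps f) /\ Gamma_rho v rho (of_ps f).
Proof.
move=> /andP[rho0 rho1] f0 fle.
have f1 i : v (of_ps f i) <= 1.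
  case: i => n /=; last by rewrite (abs0 v_abs).
  by rewrite (le_trans (fle n)) // exprn_ile1 // ltW.
have v0 : v (of_ps f 0) = 1 by rewrite /= f0 (abs1 v_abs).
have Gf : Gamma_rho v rho (of_ps f).
  split=> //.
  - split; first by exists 1 => _ [i _ <-].
    apply: (@squeeze_cvgr _ _ _ _ (fun=> 0) (fun n => rho ^+ n)).
    + by apply: nearW => n; rewrite (abs_ge0 v_abs) fle.
    + exact: cvg_cst.
    + by apply: cvg_expr; rewrite ger0_norm.
  - by move=> E; move: v0; rewrite E (abs0 v_abs) => /esym/eqP; rewrite oner_eq0.
  - apply/eqP; rewrite eq_le; apply/andP; split.
      by apply: ge_sup => [|_ [i _ <-]] //; exists (v (of_ps f 0)), 0.
    apply: ub_le_sup; first by exists 1 => _ [i _ <-].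
    by exists 0.
  - by move=> n _; exact: fle.
split=> //; split=> //; last by move=> [].
by exists rho => //=; rewrite rho0 rho1.
Qed.

End Loops.

Section HmuSeries.
Variables (R : realType) (p : nat) (K : fieldType) (v : K -> R).
Hypotheses (p_prime : prime p) (v_abs : nonarchimedean_abs v).
Hypothesis v_nat : forall n, (0 < n)%N -> v n%:R = (p%:R ^+ logn p n)^-1.

Lemma hseries0 (pi : K) : hseries p pi 0%N = 1.
Proof. by rewrite hseriesE expr0 mul1r artin_hasse0. Qed.

Lemma hmuseries0 g (mu : 'I_g -> nat) (pi : 'I_g -> K) : hmuseries p mu pi 0%N = 1.
Proof.
apply: (big_ind (fun f => f 0%N = 1)) => // [f1 f2 E1 E2|i _].
  by rewrite psmul0 E1 E2 mulr1.
by rewrite /psTpow dvdn0 div0n hseries0.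
Qed.

Lemma abs_hmuseries_le g (mu : 'I_g -> nat) (pi : 'I_g -> K) (rho : R) :
  0 <= rho -> (forall i, v (pi i) <= rho ^+ mu i) ->
  forall n, v (hmuseries p mu pi n) <= rho ^+ n.
Proof.
move=> rho0 pile; apply: (big_ind (fun f => forall n, v (f n) <= rho ^+ n)).
- move=> n; rewrite /psone; case: n => [|n]; first by rewrite (abs1 v_abs).
  by rewrite (abs0 v_abs) exprn_ge0.
- by move=> f1 f2 E1 E2; exact: abs_psmul_le.
- move=> i _; apply: (abs_psTpow_le v_abs) => // n.
  rewrite (le_trans (abs_hseries_le p_prime v_abs v_nat _ _)) //.
  by rewrite lerXn2r ?nnegrE ?exprn_ge0 ?(abs_ge0 v_abs).
Qed.

Lemma abs_hmuseries_top g (pi : 'I_g -> K) (last : 'I_g) :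
  last.+1 = g -> v (pi last) < 1 -> (forall i, v (pi i) <= v (pi last)) ->
  v (hmuseries p (fun i : 'I_g => i.+1) pi g) = v (pi last).
Proof.
move=> lastE pi1 pile; set c := v (pi last) in pi1 pile *.
have c0 : 0 <= c := abs_ge0 v_abs _.
have pil i : v (pi i) <= 1 := le_trans (pile i) (ltW pi1).
have g0 : (0 < g)%N by rewrite -lastE.
pose F (i : 'I_g) := psTpow i.+1 (hseries p (pi i)).
have Fc (i : 'I_g) m : (0 < m)%N -> v (F i m) <= c.
  move=> m0; rewrite /F /psTpow; case: ifP => [im|_]; last by rewrite (abs0 v_abs).
  rewrite (le_trans (abs_hseries_le p_prime v_abs v_nat _ _)) //.
  rewrite (le_trans _ (pile i)) // ler_iXnr ?(abs_ge0 v_abs) //.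
  by rewrite divn_gt0 // dvdn_leq.
have F0 i : F i 0%N = 1 by rewrite /F /psTpow dvdn0 div0n hseries0.
have Fg : v (\sum_i F i g - pi last) <= c ^+ 2.
  rewrite (bigD1 last) //= {1}/F /psTpow lastE dvdnn divnn g0 hseriesE expr1.
  rewrite (artin_hasse_small p_prime v_abs v_nat) ?prime_gt1 // (_ : 1`! = 1%N) // invr1 mulr1.
  rewrite [pi last + _]addrC addrK; apply: (abs_sum_le v_abs) => [|i i_last]; first exact: exprn_ge0.
  rewrite /F /psTpow; case: ifP => [ig|_]; last by rewrite (abs0 v_abs) exprn_ge0.
  rewrite (le_trans (abs_hseries_le p_prime v_abs v_nat _ _)) //.
  have i_lt : (i.+1 < g)%N.
    rewrite ltn_neqAle ltn_ord andbT; apply: contra_neq i_last => i_g.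
    by apply: val_inj; apply: succn_inj; rewrite i_g lastE.
  have d2 : (2 <= g %/ i.+1)%N.
    rewrite ltnNge; apply/negP => d1; move: i_lt; rewrite ltnNge => /negP; apply.
    by rewrite -{1}(divnK ig) -[X in (_ <= X)%N]mul1n leq_mul2r d1 orbT.
  rewrite (@le_trans _ _ (v (pi i) ^+ 2)) //.
    by rewrite ler_wiXn2l ?(abs_ge0 v_abs).
  by rewrite lerXn2r ?nnegrE ?(abs_ge0 v_abs).
have c01 : 0 <= c <= 1 by rewrite c0 ltW.
have := abs_psprod_linear v_abs (index_enum 'I_g) c01 F0 Fc g0.
rewrite -/(hmuseries p (fun i : 'I_g => i.+1) pi); set hg := (_ g) => hF.
have hle : v (hg - pi last) <= c ^+ 2.
  by rewrite -(subrK (\sum_i F i g) hg) -addrA (absD_le v_abs).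
have [cz|cnz] := eqVneq c 0.
  move: hle; rewrite cz expr0n /= => hle; apply/eqP.
  rewrite eq_le (abs_ge0 v_abs) andbT (abs_le_of_diff v_abs hle) //.
  by rewrite -/c cz.
apply: (abs_eq_of_lt v_abs); rewrite (le_lt_trans hle) // expr2 -/c gtr_pMr //.
by rewrite lt_def cnz.
Qed.

Lemma schur_row (h : biseries K) (kappa : int_partition) g : (0 < g)%N ->
  (forall i, kappa i = if i == 0%N then g else 0%N) ->
  schur kappa h = h g /\ pweight kappa = g.
Proof.
move=> g0 kE; have l1 : plength kappa = 1%N.
  apply/eqP; rewrite eqn_leq -plengthP kE /= ltnNge -plengthP kE /=.
  by rewrite -lt0n.
rewrite /schur pweightE; move: (plength kappa) l1 => _ ->.
by rewrite det_mx11 mxE big_ord1 kE /= subr0 addr0.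
Qed.

End HmuSeries.

(** * Completeness of finite extensions *)

Section Convergence.
Variables (R : realType) (K : fieldType) (v : K -> R).
Hypothesis v_abs : nonarchimedean_abs v.
Implicit Types (u : nat -> K) (l : K).

Lemma abs_cvgP u l : abs_cvg v u l <->
  forall e, 0 < e -> exists N, forall n, (N <= n)%N -> v (u n - l) < e.
Proof.
rewrite /abs_cvg cvgr0Pnorm_lt; split=> [cv e /cv [N _ Ne]|cv e /cv [N Ne]].
  by exists N => n Nn; have := Ne n Nn; rewrite /= ger0_norm ?(abs_ge0 v_abs).
by exists N => // n /Ne; rewrite ger0_norm ?(abs_ge0 v_abs).
Qed.

Lemma abs_cvg_le u l C : abs_cvg v u l ->
  (exists N, forall n, (N <= n)%N -> v (u n) <= C) -> v l <= C.
Proof.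
move=> /abs_cvgP cv [N uC]; apply/ler_addgt0Pr => e e0.
have [M Me] := cv e e0; set n := maxn N M.
have /ltW := Me n (leq_maxr _ _); rewrite (absBC v_abs) => le_e.
have := uC n (leq_maxl _ _) => le_C.
have C0 : 0 <= C := le_trans (abs_ge0 v_abs _) le_C.
rewrite (abs_le_of_diff v_abs (y := u n)) //.
  by rewrite (le_trans le_e) // lerDr.
by rewrite (le_trans le_C) // lerDl ltW.
Qed.

Lemma abs_cvgD u1 u2 l1 l2 : abs_cvg v u1 l1 -> abs_cvg v u2 l2 ->
  abs_cvg v (fun n => u1 n + u2 n) (l1 + l2).
Proof.
move=> /abs_cvgP cv1 /abs_cvgP cv2; apply/abs_cvgP => e e0.
have [N1 Ne1] := cv1 e e0; have [N2 Ne2] := cv2 e e0.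
exists (maxn N1 N2) => n; rewrite geq_max => /andP[/Ne1 n1 /Ne2 n2].
rewrite opprD addrACA (le_lt_trans (abs_ultra v_abs _ _)) //.
by rewrite gt_max n1.
Qed.

Lemma abs_cvgMr u l x : abs_cvg v u l -> abs_cvg v (fun n => u n * x) (l * x).
Proof.
move=> /abs_cvgP cv; apply/abs_cvgP => e e0.
have x1 : 0 < v x + 1 by rewrite ltr_wpDl ?(abs_ge0 v_abs).
have [N Ne] := cv (e / (v x + 1)) (divr_gt0 e0 x1).
exists N => n /Ne; rewrite -mulrBl (absM v_abs) => lt_e.
rewrite (le_lt_trans (y := v (u n - l) * (v x + 1))) -?ltr_pdivlMr //.
by rewrite ler_wpM2l ?(abs_ge0 v_abs) // lerDl.
Qed.

Lemma abs_cvg_unique u l1 l2 : abs_cvg v u l1 -> abs_cvg v u l2 -> l1 = l2.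
Proof.
move=> cv1 cv2; apply/eqP; rewrite -subr_eq0; apply/eqP/(abs_eq0 v_abs)/eqP.
rewrite eq_le (abs_ge0 v_abs) andbT.
apply: (@abs_cvg_le (fun n => u n + u n * (-1))); last first.
  by exists 0%N => n _; rewrite mulrN1 subrr (abs0 v_abs).
by rewrite -[- l2]mulrN1; apply: abs_cvgD => //; exact: abs_cvgMr.
Qed.

Lemma abs_cvg_cst l : abs_cvg v (fun=> l) l.
Proof.
by apply/abs_cvgP => e e0; exists 0%N => n _; rewrite subrr (abs0 v_abs).
Qed.

Lemma abs_lim_eq u l : abs_cvg v u l -> abs_lim v u = l.
Proof.
move=> cv; rewrite /abs_lim; case: xgetP => [l' _ cv'|/(_ l)] //.
exact: abs_cvg_unique cv' cv.
Qed.

Lemma abs_cauchy_of_steps u :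
  (forall e, 0 < e -> exists N, forall n, (N <= n)%N -> v (u n.+1 - u n) < e) ->
  abs_cauchy v u.
Proof.
move=> steps e e0; have [N Ne] := steps e e0; exists N.
have far n m : (N <= n)%N -> v (u (n + m)%N - u n) < e.
  move=> Nn; elim: m => [|m IH]; first by rewrite addn0 subrr (abs0 v_abs).
  rewrite -(subrK (u (n + m)%N) (u _)) -addrA (le_lt_trans (abs_ultra v_abs _ _)) //.
  by rewrite gt_max IH addnS Ne // (leq_trans Nn) // leq_addr.
move=> m n Nm Nn; case: (leqP n m) => [nm|/ltnW mn].
  by rewrite -(subnKC nm) far.
by rewrite -(subnKC mn) (absBC v_abs) far.
Qed.

End Convergence.

Section FiniteExtension.
Variables (R : realType) (F : fieldType) (w : F -> R).
Hypotheses (w_abs : nonarchimedean_abs w)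
  (w_complete : forall u, abs_cauchy w u -> exists l, abs_cvg w u l).
Variables (K : fieldExtType F) (v : K -> R).
Hypotheses (v_abs : nonarchimedean_abs v) (v_ext : forall a : F, v a%:A = w a).

Lemma abs_scale (a : F) (x : K) : v (a *: x) = w a * v x.
Proof. by rewrite -[x in LHS]mul1r scalerAl (absM v_abs) v_ext. Qed.

Definition complete_span (X : seq K) :=
  forall u, (forall n, u n \in <<X>>%VS) -> abs_cauchy v u ->
  exists2 l, l \in <<X>>%VS & abs_cvg v u l.

Lemma dist_complete_span X e : complete_span X -> e \notin <<X>>%VS ->
  exists2 d, 0 < d & forall x, x \in <<X>>%VS -> d <= v (e - x).
Proof.
move=> Xc eX; apply: contrapT => /forall2NP far.
have close n : exists x, x \in <<X>>%VS /\ v (e - x) < n.+1%:R^-1.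
  have [|/existsNP[x /not_implyP[xX /negP]]] := far n.+1%:R^-1.
    by move=> /negP; rewrite invr_gt0 ltr0n.
  by rewrite -ltNge; exists x.
have [x xP] := choice close.
have cvx : abs_cvg v x e.
  apply/(abs_cvgP v_abs) => eps eps0.
  exists (Num.truncn eps^-1) => n le_n; have [_] := xP n.
  rewrite (absBC v_abs) => /lt_le_trans -> //.
  rewrite -[eps]invrK lef_pV2 ?posrE ?invr_gt0 ?ltr0n //.
  rewrite ltW // (lt_le_trans (truncnS_gt _)) ?ler_nat //.
have [l lX cvl] : exists2 l, l \in <<X>>%VS & abs_cvg v x l.
  apply: Xc => [n|]; first by have [] := xP n.
  move=> eps eps0; have [N Ne] := (abs_cvgP v_abs _ _).1 cvx eps eps0.
  exists N => m n /Ne m1 /Ne n1.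
  rewrite -(subrK e (x m)) -addrA (le_lt_trans (abs_ultra v_abs _ _)) //.
  by rewrite gt_max m1 (absBC v_abs).
by move: eX; rewrite (abs_cvg_unique v_abs cvx cvl) lX.
Qed.

Lemma complete_span_all X : complete_span X.
Proof.
elim: X => [|e X Xc] u uX uc.
  exists 0; first exact: mem0v.
  rewrite (_ : u = fun=> 0); first exact: abs_cvg_cst.
  by apply/funext => n; apply/eqP; rewrite -memv0 -(span_nil K) uX.
have [eX|eX] := boolP (e \in <<X>>%VS).
  have E : <<e :: X>>%VS = <<X>>%VS by rewrite span_cons; apply/addv_idPr.
  by rewrite E; apply: Xc => // n; rewrite -E.
have [d d0 dP] := dist_complete_span Xc eX.
have dist a x : x \in <<X>>%VS -> d * w a <= v (a *: e + x).
  move=> xX; have [->|a0] := eqVneq a 0.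
    by rewrite (abs0 w_abs) mulr0 (abs_ge0 v_abs).
  have -> : a *: e + x = a *: (e - - (a^-1 *: x)).
    by rewrite opprK scalerDr scalerA divff // scale1r.
  by rewrite abs_scale mulrC ler_wpM2l ?(abs_ge0 w_abs) // dP // memvN memvZ.
have /choice[ax axP] n : exists ax : F * K, ax.2 \in <<X>>%VS /\ u n = ax.1 *: e + ax.2.
  have := uX n; rewrite span_cons => /memv_addP[_ /vlineP[a ->] [x xX ->]].
  by exists (a, x).
pose a n := (ax n).1; pose x n := (ax n).2.
have aC : abs_cauchy w a.
  move=> eps eps0; have [N Ne] := uc (d * eps) (mulr_gt0 d0 eps0).
  exists N => m n Nm Nn; rewrite -(ltr_pM2l d0).
  have [xm um] := axP m; have [xn un] := axP n.
  rewrite (le_lt_trans (dist _ (x m - x n) _)) ?memvB //.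
  by rewrite scalerBl addrACA -opprD -um -un Ne.
have [la cva] := w_complete aC.
have cvae : abs_cvg v (fun n => a n *: e) (la *: e).
  apply/(abs_cvgP v_abs) => eps eps0.
  have e1 : 0 < v e + 1 by rewrite ltr_wpDl ?(abs_ge0 v_abs).
  have [N Ne] := (abs_cvgP w_abs _ _).1 cva _ (divr_gt0 eps0 e1).
  exists N => n /Ne; rewrite -scalerBl abs_scale ltr_pdivlMr //; apply: le_lt_trans.
  by rewrite ler_wpM2l ?(abs_ge0 w_abs) // lerDl.
have xE n : x n = u n + - (a n *: e).
  by have [_ ->] := axP n; rewrite addrAC subrr add0r.
have [lx lxX cvx] : exists2 l, l \in <<X>>%VS & abs_cvg v x l.
  apply: Xc => [n|]; first by have [] := axP n.
  move=> eps eps0; have [N1 Ne1] := uc eps eps0.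
  have [N2 Ne2] := (abs_cvgP v_abs _ _).1 cvae eps eps0.
  exists (maxn N1 N2) => m n; rewrite !geq_max => /andP[m1 m2] /andP[n1 n2].
  have -> : x m - x n = (u m - u n) + ((a n *: e - la *: e) - (a m *: e - la *: e)).
    by rewrite !xE; ring.
  have b1 := Ne1 m n m1 n1; have b2 := Ne2 m m2; have b3 := Ne2 n n2.
  rewrite (le_lt_trans (abs_ultra v_abs _ _)) // gt_max b1.
  rewrite (le_lt_trans (abs_ultra v_abs _ _)) // gt_max b3.
  by rewrite (absN v_abs).
exists (la *: e + lx).
  by rewrite span_cons memv_add // memvZ // memv_line.
rewrite (_ : u = fun n => a n *: e + x n); first exact: abs_cvgD.
by apply/funext => n; have [_ ->] := axP n.
Qed.

Lemma complete_fieldExt u : abs_cauchy v u -> exists l, abs_cvg v u l.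
Proof.
move=> uc; have [|l _ cv] := @complete_span_all (vbasis {:K}) u _ uc; last by exists l.
by move=> n; rewrite (span_basis (vbasisP _)) memvf.
Qed.

End FiniteExtension.

(** * Operators on H *)

Section BiseriesSpaces.
Variables (R : realType) (K : fieldType) (v : K -> R).
Hypothesis v_abs : nonarchimedean_abs v.
Implicit Types (a b x y : biseries K) (C D : R).

Definition coef_bound D x := forall i, v (x i) <= D.

Lemma coef_bound0 D : 0 <= D -> coef_bound D 0.
Proof. by move=> D0 i; rewrite (abs0 v_abs). Qed.

Lemma coef_boundD D x y : coef_bound D x -> coef_bound D y -> coef_bound D (x + y).
Proof. by move=> xD yD i; exact: (absD_le v_abs). Qed.

Lemma coef_boundN D x : coef_bound D x -> coef_bound D (- x).
Proof. by move=> xD i; rewrite (absN v_abs). Qed.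

Lemma coef_boundB D x y : coef_bound D x -> coef_bound D y -> coef_bound D (x - y).
Proof. by move=> xD yD; apply: coef_boundD => //; exact: coef_boundN. Qed.

Lemma coef_boundZ c D x : coef_bound D x -> coef_bound (v c * D) (c *: x).
Proof. by move=> xD i; rewrite (absM v_abs) ler_wpM2l ?(abs_ge0 v_abs). Qed.

Lemma coef_bound_ge0 D x : coef_bound D x -> 0 <= D.
Proof. by move=> xD; exact: le_trans (abs_ge0 v_abs (x 0)) (xD 0). Qed.

Lemma coef_bound_le C D x : C <= D -> coef_bound C x -> coef_bound D x.
Proof. by move=> CD xC i; exact: le_trans (xC i) CD. Qed.

Lemma coef_bound_eq0 x : (forall e, 0 < e -> coef_bound e x) -> x = 0.
Proof.
move=> xe; apply/funext => i; apply/(abs_eq0 v_abs)/eqP.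
by rewrite eq_le (abs_ge0 v_abs) andbT; apply/ler_addgt0Pl => e /xe; rewrite addr0.
Qed.

Definition decays x := forall e, 0 < e -> exists N, forall n, (N <= n)%N -> v (x n%:Z) < e.

Lemma HspaceP x : Hspace v x <-> (exists D, coef_bound D x) /\ decays x.
Proof.
rewrite /Hspace /= cvgr0Pnorm_lt; split=> [[[D xD] xc]|[[D xD] xd]].
  split=> [|e /xc [N _ Ne]]; first by exists D => i; apply: xD; exists i.
  by exists N => n Nn; have := Ne n Nn; rewrite /= ger0_norm ?(abs_ge0 v_abs).
split=> [|e /xd [N Ne]]; first by exists D => _ [i _ <-].
by exists N => // n /Ne; rewrite ger0_norm ?(abs_ge0 v_abs).
Qed.

Lemma decays_lin c x y : decays x -> decays y -> decays (c *: x + y).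
Proof.
move=> xd yd e e0; have c1 : 0 < v c + 1 by rewrite ltr_wpDl ?(abs_ge0 v_abs).
have [N1 Ne1] := xd _ (divr_gt0 e0 c1); have [N2 Ne2] := yd e e0.
exists (maxn N1 N2) => n; rewrite geq_max => /andP[/Ne1 n1 /Ne2 n2].
rewrite (le_lt_trans (abs_ultra v_abs _ _)) // gt_max n2 andbT (absM v_abs).
rewrite (le_lt_trans _ (_ : (v c + 1) * v (x n) < e)) //.
  by rewrite ler_wpM2r ?(abs_ge0 v_abs) // lerDl.
by rewrite mulrC -ltr_pdivlMr.
Qed.

Lemma Hspace_lin c x y : Hspace v x -> Hspace v y -> Hspace v (c *: x + y).
Proof.
move=> /HspaceP[[C xC] xd] /HspaceP[[D yD] yd]; apply/HspaceP.
split; last exact: decays_lin.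
exists (Num.max (v c * C) D); apply: coef_boundD.
  by apply: coef_bound_le (coef_boundZ c xC); rewrite le_max lexx.
by apply: coef_bound_le yD; rewrite le_max lexx orbT.
Qed.

Lemma Hspace0 : Hspace v 0.
Proof.
apply/HspaceP; split; first by exists 0; exact: coef_bound0.
by move=> e e0; exists 0%N => n _; rewrite (abs0 v_abs).
Qed.

Lemma Hplus_lin c x y : Hplus v x -> Hplus v y -> Hplus v (c *: x + y).
Proof.
move=> [xH x0] [yH y0]; split; first exact: Hspace_lin.
by move=> i i0; rewrite /= -[LHS]/(c * x i + y i) x0 // y0 // mulr0 addr0.
Qed.

Lemma Hplus0 : Hplus v 0. Proof. by split; first exact: Hspace0. Qed.

Lemma HplusD x y : Hplus v x -> Hplus v y -> Hplus v (x + y).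
Proof. by move=> xH yH; rewrite -[x]scale1r; exact: Hplus_lin. Qed.

Lemma HplusB x y : Hplus v x -> Hplus v y -> Hplus v (x - y).
Proof. by move=> xH yH; rewrite addrC -scaleN1r; exact: Hplus_lin. Qed.

Lemma Hplus_bound x : Hplus v x -> exists D, coef_bound D x.
Proof. by move=> [/HspaceP[]]. Qed.

Lemma Hnorm_ge x i : Hspace v x -> v (x i) <= Hnorm v x.
Proof. by move=> [xb _]; apply: ub_le_sup => //; exists i. Qed.

Lemma Hnorm_le D x : coef_bound D x -> Hnorm v x <= D.
Proof. by move=> xD; apply: ge_sup => [|_ [i _ <-]]; [exists (v (x 0)), 0 | exact: xD]. Qed.

Section LinearOn.
Variable f : biseries K -> biseries K.
Hypothesis f_lin : linear_on (Hplus v) f.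

Lemma linear_on0 : f 0 = 0.
Proof.
have := f_lin 1 Hplus0 Hplus0; rewrite !scale1r addr0 => /eqP.
by rewrite -subr_eq subrr eq_sym => /eqP.
Qed.

Lemma linear_onB x y : Hplus v x -> Hplus v y -> f (x - y) = f x - f y.
Proof. by move=> xH yH; rewrite addrC -scaleN1r f_lin // scaleN1r addrC. Qed.

Definition bounded_by C :=
  forall x D, Hplus v x -> coef_bound D x -> coef_bound (C * D) (f x).

Lemma bounded_by_opnorm C : (forall x, Hplus v x -> Hspace v (f x)) ->
  0 <= C -> (opnorm v f <= C%:E)%E -> bounded_by C.
Proof.
move=> fH C0 fC x D xH xD i.
have [->|/eqP x0] := pselect (x = 0).
  by rewrite linear_on0 (abs0 v_abs) mulr_ge0 // (coef_bound_ge0 xD).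
have [j xj] : exists j, x j != 0.
  apply: contrapT => /forallNP x00; apply: (negP x0); apply/eqP/funext => j.
  by apply/eqP; apply: contrapT => /negP; exact: x00.
have nx : 0 < Hnorm v x.
  rewrite (lt_le_trans _ (Hnorm_ge j _)) //; last by case: xH.
  by rewrite lt_def (abs_neq0 v_abs) // (abs_ge0 v_abs).
rewrite (le_trans (Hnorm_ge i (fH _ xH))) //.
apply: (@le_trans _ _ (C * Hnorm v x)); last by rewrite ler_wpM2l // Hnorm_le.
rewrite -ler_pdivrMr // -lee_fin; apply: le_trans fC.
by apply: ereal_sup_ubound; exists x => //; split=> //; exact/eqP.
Qed.

End LinearOn.

Hypothesis v_complete : forall u, abs_cauchy v u -> exists l, abs_cvg v u l.

Lemma half_pow_small D e : 0 < e -> exists k, D * 2^-1 ^+ k < e.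
Proof.
move=> e0; have D1 : 0 < `|D| + 1 by rewrite ltr_wpDl.
have h1 : `|2^-1 : R| < 1 by rewrite ger0_norm ?invr_ge0 // invf_lt1 // ltr1n.
have /cvgr0Pnorm_lt /(_ _ (divr_gt0 e0 D1)) [k _ /(_ k (leqnn k)) /=] := cvg_expr h1.
rewrite ger0_norm ?exprn_ge0 ?invr_ge0 // ltr_pdivlMr // => lt_e.
exists k; rewrite (le_lt_trans _ lt_e) // mulrC ler_wpM2l ?exprn_ge0 ?invr_ge0 //.
by rewrite (le_trans (ler_norm D)) // lerDl.
Qed.

Lemma coef_bound_half_eq0 D x :
  (forall k, coef_bound (D * 2^-1 ^+ k) x) -> x = 0.
Proof.
move=> xk; apply: coef_bound_eq0 => e e0.
by have [k /ltW De] := half_pow_small D e0; exact: coef_bound_le De (xk k).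
Qed.

Lemma neumann (f : biseries K -> biseries K) b D :
  set_fun (Hplus v) (Hplus v) f -> linear_on (Hplus v) f -> bounded_by f 2^-1 ->
  Hplus v b -> coef_bound D b ->
  exists x, [/\ Hplus v x, coef_bound D x & x + f x = b].
Proof.
move=> fH f_lin f_half bH bD; have D0 := coef_bound_ge0 bD.
pose X k := iter k (fun x => b - f x) 0.
have XS k : X k.+1 = b - f (X k) by [].
have half01 : 0 <= (2^-1 : R) <= 1 by rewrite invr_ge0 ler0n invf_le1 // ler1n.
have /andP[half0 half1] := half01.
have XH k : Hplus v (X k).
  by elim: k => [|k IH]; [exact: Hplus0 | rewrite XS; apply: HplusB => //; exact: fH].
have step k : coef_bound (D * 2^-1 ^+ k) (X k.+1 - X k).
  elim: k => [|k IH]; first by rewrite XS (linear_on0 f_lin) !subr0 expr0 mulr1.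
  have -> : X k.+2 - X k.+1 = - f (X k.+1 - X k).
    rewrite [LHS](_ : _ = (b - f (X k.+1)) - (b - f (X k))) // (linear_onB f_lin) //.
    by rewrite [in LHS]opprB [LHS]addrC [LHS]addrA subrK opprB.
  rewrite exprS mulrCA; apply: coef_boundN; apply: f_half; last exact: IH.
  exact: HplusB.
have far k m : coef_bound (D * 2^-1 ^+ k) (X (k + m)%N - X k).
  elim: m => [|m IH]; first by rewrite addn0 subrr; apply: coef_bound0; rewrite mulr_ge0 ?exprn_ge0.
  rewrite addnS -(subrK (X (k + m)%N) (X _.+1)) -addrA; apply: coef_boundD => //.
  apply: coef_bound_le (step (k + m)%N).
  by rewrite ler_wpM2l // exprD ler_piMr ?exprn_ge0 // exprn_ile1.
have /choice[x xP] i : exists l, abs_cvg v (fun k => X k i) l.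
  apply: v_complete; apply: (abs_cauchy_of_steps v_abs) => e e0.
  have [N Ne] := half_pow_small D e0; exists N => n Nn; apply: le_lt_trans Ne.
  rewrite (le_trans (step n i)) // -(subnKC Nn) exprD.
  by rewrite ler_wpM2l // ler_piMr ?exprn_ge0 // exprn_ile1.
have close k : coef_bound (D * 2^-1 ^+ k) (x - X k).
  move=> i; apply: (abs_cvg_le v_abs (u := fun n => X n i + - X k i)).
    by apply: abs_cvgD => //; exact: abs_cvg_cst.
  by exists k => n kn; rewrite -(subnKC kn); exact: far.
have xD : coef_bound D x.
  have := close 0%N; rewrite /X /= subr0 expr0 mulr1; exact.
have xH : Hplus v x.
  split.
    apply/HspaceP; split=> [|e e0]; first by exists D.
    have [k Dk] := half_pow_small D e0.
    have [/HspaceP[_ /(_ e e0)[N Ne]] _] := XH k.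
    exists N => n /Ne lt_e; rewrite -(subrK (X k n) (x n)).
    rewrite (le_lt_trans (abs_ultra v_abs _ _)) // gt_max lt_e andbT.
    by rewrite (le_lt_trans _ Dk) //; exact: close.
  move=> i i0; apply: (abs_cvg_unique v_abs (xP i)).
  rewrite (_ : (fun k => _) = fun=> 0); first exact: abs_cvg_cst.
  by apply/funext => k; have [_ ->] := XH k.
exists x; split=> //; apply/eqP; rewrite -subr_eq0; apply/eqP.
apply: (@coef_bound_half_eq0 D) => k.
have -> : x + f x - b = (x - X k.+1) + f (x - X k).
  by rewrite (linear_onB f_lin) // XS opprB [RHS]addrC [RHS]addrACA addKr [f x + x]addrC.
apply: coef_boundD.
  apply: coef_bound_le (close k.+1).
  by rewrite exprS ler_wpM2l // ler_piMl ?exprn_ge0.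
apply: coef_bound_le (f_half _ _ (HplusB xH (XH k)) (close k)).
by rewrite ler_piMl // mulr_ge0 ?exprn_ge0.
Qed.

Lemma neumann_inj (f : biseries K -> biseries K) x :
  linear_on (Hplus v) f -> bounded_by f 2^-1 -> Hplus v x -> x + f x = 0 -> x = 0.
Proof.
move=> f_lin f_half xH /eqP; rewrite addr_eq0 => /eqP xE.
have [D xD] := Hplus_bound xH; apply: (@coef_bound_half_eq0 D).
elim=> [|k IH]; first by rewrite expr0 mulr1.
by rewrite xE exprS mulrCA; apply: coef_boundN; exact: f_half.
Qed.

End BiseriesSpaces.

(** * Density of the algebraic part *)

Section Density.
Variables (R : realType) (K : fieldType) (v : K -> R).
Hypothesis v_abs : nonarchimedean_abs v.
Implicit Types (a b x y p q : biseries K) (C D : R).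

Definition Tpolynomial p := Hplus v p /\ exists N : nat, forall i, N%:Z < i -> p i = 0.

Lemma Tpolynomial_lin c p q : Tpolynomial p -> Tpolynomial q -> Tpolynomial (c *: p + q).
Proof.
move=> [pH [N pN]] [qH [M qM]]; split; first exact: Hplus_lin.
exists (maxn N M) => i lt_i.
by rewrite -[LHS]/(c * p i + q i) pN ?qM ?mulr0 ?addr0 //; lia.
Qed.

Lemma Tpolynomial_approx b e : Hplus v b -> 0 < e ->
  exists2 p, Tpolynomial p & coef_bound v e (b - p).
Proof.
move=> bH e0; have [D bD] := Hplus_bound v_abs bH.
have [/HspaceP-/(_ v_abs)[_ /(_ e e0)[N Ne]] b0] := bH.
exists (fun i => if i <= N%:Z then b i else 0).
  split; last by exists N => i; rewrite ltNge => /negPf ->.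
  split; last by move=> i i0 /=; case: ifP => // _; exact: b0.
  apply/(HspaceP v_abs); split.
    exists D => i /=; case: ifP => // _; rewrite (abs0 v_abs).
    exact: coef_bound_ge0 bD.
  move=> eps eps0; exists N.+1 => n Nn.
  by rewrite ifF ?(abs0 v_abs) //; apply/negbTE; rewrite -ltNge; lia.
move=> i; rewrite -[(b - _) i]/(b i - (if i <= N%:Z then b i else 0)).
case: (leP i N%:Z) => [_|lt_i]; first by rewrite subrr (abs0 v_abs) ltW.
rewrite subr0; case: i lt_i => // n lt_n; apply/ltW/Ne; lia.
Qed.

Definition bounded_functional (phi : biseries K -> K) :=
  (forall c x y, Hplus v x -> Hplus v y -> phi (c *: x + y) = c * phi x + phi y) /\
  exists2 C, 0 <= C & forall x D, Hplus v x -> coef_bound v D x -> v (phi x) <= C * D.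

(* Polynomials are dense in each closed affine subspace of finite codimension. *)
Lemma Tpolynomial_interpolation (phi : nat -> biseries K -> K) n b e :
  (forall k, bounded_functional (phi k)) -> Hplus v b -> 0 < e ->
  exists p, [/\ Tpolynomial p, forall k, (k < n)%N -> phi k p = phi k b &
                coef_bound v e (b - p)].
Proof.
move=> phiP; have phiB k x y : Hplus v x -> Hplus v y -> phi k (x - y) = phi k x - phi k y.
  move=> xH yH; have [lin _] := phiP k.
  by rewrite addrC -scaleN1r lin // mulN1r addrC.
elim: n b e => [|n IH] b e bH e0.
  by have [p pT pe] := Tpolynomial_approx bH e0; exists p; split.
have [lin [C C0 phiC]] := phiP n.
have [[q [qT qn q0]]|noq] := pselect (exists q, [/\ Tpolynomial q,
    forall k, (k < n)%N -> phi k q = 0 & phi n q != 0]).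
  have [qH _] := qT; have [Q qQ] := Hplus_bound v_abs qH.
  have Q0 := coef_bound_ge0 v_abs qQ.
  set M := C * Q / v (phi n q).
  have M0 : 0 <= M by rewrite !mulr_ge0 ?invr_ge0 ?(abs_ge0 v_abs).
  have M1 : 0 < M + 1 by rewrite ltr_wpDl.
  have [|p [pT pn pe]] := IH b (e / (M + 1)) bH; first by rewrite divr_gt0.
  have [pH _] := pT; have bpH : Hplus v (b - p) by exact: HplusB.
  set t := phi n (b - p) / phi n q.
  exists (t *: q + p); split; first exact: Tpolynomial_lin.
    move=> k; rewrite ltnS leq_eqVlt => /orP[/eqP->|kn].
      by rewrite lin // /t divfK // phiB // subrK.
    have [link _] := phiP k; rewrite link // qn // mulr0 add0r; exact: pn.
  rewrite [t *: q + p]addrC opprD addrA; apply: coef_boundB => //.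
    by apply: coef_bound_le pe; rewrite ler_pdivrMr // ler_peMr ?(ltW e0) // lerDr.
  apply: coef_bound_le (coef_boundZ v_abs t qQ).
  rewrite (absM v_abs) (absV v_abs).
  have := phiC _ _ bpH pe => le1.
  rewrite (@le_trans _ _ (C * (e / (M + 1)) / v (phi n q) * Q)) //.
    by rewrite ler_wpM2r // ler_wpM2r // invr_ge0 (abs_ge0 v_abs).
  have -> : C * (e / (M + 1)) / v (phi n q) * Q = e * (M / (M + 1)).
    by rewrite /M; ring.
  by rewrite ler_piMr ?(ltW e0) // ler_pdivrMr // mul1r lerDl.
have [p [pT pn pe]] := IH b e bH e0; exists p; split=> // k.
rewrite ltnS leq_eqVlt => /orP[/eqP->|]; last exact: pn.
have [pH _] := pT; have bpH : Hplus v (b - p) by exact: HplusB.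
apply/esym/eqP; rewrite -subr_eq0 -phiB //; apply/eqP/(abs_eq0 v_abs)/eqP.
rewrite eq_le (abs_ge0 v_abs) andbT; apply/ler_addgt0Pl => eps eps0; rewrite addr0.
have C1 : 0 < C + 1 by rewrite ltr_wpDl.
have [q [qT qn qe]] := IH (b - p) (eps / (C + 1)) bpH (divr_gt0 eps0 C1).
have [qH _] := qT.
have qn0 : phi n q = 0.
  apply: contrapT => /eqP q0; apply: noq; exists q; split=> // j jn.
  by rewrite qn // phiB // pn // subrr.
have := phiC _ _ (HplusB v_abs bpH qH) qe; rewrite phiB // qn0 subr0 => /le_trans; apply.
by rewrite mulrCA ler_piMr ?(ltW eps0) // ler_pdivrMr // mul1r lerDl.
Qed.

Lemma separating_coordinates n (e : 'I_n -> biseries K) :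
  exists js : seq int, forall c : 'I_n -> K,
    (forall j, j \in js -> (\sum_i c i *: e i) j = 0) -> \sum_i c i *: e i = 0.
Proof.
elim: n e => [|n IH] e; first by exists [::] => c _; rewrite big_ord0.
have [js jsP] := IH (fun i => e (widen_ord (leqnSn n) i)).
pose x (c : 'I_n.+1 -> K) := \sum_i c i *: e i.
have [[c [cjs /eqP c0]]|none] := pselect (exists c, (forall j, j \in js -> x c j = 0) /\ x c <> 0);
  last first.
  by exists js => c cjs; apply: contrapT => xc; apply: none; exists c.
have xlin t c1 c2 : x (fun i => t * c1 i + c2 i) = t *: x c1 + x c2.
  rewrite /x scaler_sumr -big_split; apply: eq_bigr => i _ /=.
  by rewrite scalerDl scalerA.
have short c1 : c1 ord_max = 0 -> (forall j, j \in js -> x c1 j = 0) -> x c1 = 0.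
  move=> c1n; rewrite /x big_ord_recr /= c1n scale0r addr0; exact: jsP.
have cn : c ord_max != 0.
  by apply: contra_neq c0 => cn; exact: short.
have [j0 xj0] : exists j, x c j != 0.
  apply: contrapT => /forallNP x00; move/eqP: c0; apply; apply/funext => j.
  by apply/eqP; apply: contrapT => /negP; exact: x00.
exists (j0 :: js) => d dP; rewrite -/(x d) in dP *.
set t := d ord_max / c ord_max.
have E : (- t) *: x c + x d = 0.
  rewrite -xlin; apply: short => [|j jjs].
    by rewrite mulNr /t divfK // addNr.
  rewrite xlin -[LHS]/(- t * x c j + x d j) cjs // dP ?mulr0 ?addr0 //.
  by rewrite inE jjs orbT.
have xd : x d = t *: x c.
  by move/eqP: E; rewrite scaleNr addrC subr_eq0 => /eqP.
have := dP j0 (mem_head _ _); rewrite xd => /eqP.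
rewrite -[(t *: x c) j0]/(t * x c j0) mulf_eq0 (negPf xj0) orbF => /eqP ->.
by rewrite scale0r.
Qed.

Hypothesis v_complete : forall u, abs_cauchy v u -> exists l, abs_cvg v u l.

Lemma bounded_by_finite_opnorm f : linear_on (Hplus v) f ->
  (forall x, Hplus v x -> Hspace v (f x)) -> (opnorm v f < +oo)%E ->
  exists2 C, 0 <= C & bounded_by v f C.
Proof.
move=> f_lin fH; case E : (opnorm v f) => [r||] // _.
  exists (Num.max 0 r); first by rewrite le_max lexx.
  by apply: bounded_by_opnorm => //; rewrite ?le_max ?lexx // E lee_fin le_max lexx orbT.
by exists 0 => //; apply: bounded_by_opnorm => //; rewrite E leNye.
Qed.

(* Write [w2 = f + g] with [f] of finite rank and [g] of norm at most 1/2.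
   Moving [x] by [(1 + g)^-1 (b - p)], where [b = x + w2 x] and [p] is a nearby
   polynomial with [f ((1 + g)^-1 p) = f ((1 + g)^-1 b)], makes [x + w2 x]
   equal to [p]. *)
Lemma alg_dense W y e : Gr_an v W -> W y -> 0 < e ->
  exists2 y', alg W y' & coef_bound v e (y - y').
Proof.
move=> [w [wH w_lin _ -> [i0 [w1 [w2 [[w1H w1_lin] w1n [w2H w2_lin] [w2n [F Ffin Fcv]] wE]]]]]].
move=> [x xH <-] e0.
have [n Fn] : exists n, (opnorm v (fun x => (F n x - w2 x)%R) <= (2^-1)%:E)%E.
  have nb : nbhs 0%E [set z : \bar R | (z < (2^-1)%:E)%E].
    by apply: open_nbhs_nbhs; split; [exact: open_ereal_lt_ereal | rewrite /= lte_fin invr_gt0].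
  by have [n _ /(_ n (leqnn n)) /ltW] := Fcv _ nb; exists n.
have [fH f_lin f_bd [m [es [_ esP]]]] := Ffin n; set f := F n in fH f_lin f_bd esP Fn.
have inH (k : biseries K -> biseries K) : set_fun (Hplus v) (Hplus v) k ->
    forall z, Hplus v z -> Hspace v (k z).
  by move=> kH z /kH [].
have [C C0 fC] := bounded_by_finite_opnorm f_lin (inH _ fH) f_bd.
pose g z := w2 z - f z.
have gH : set_fun (Hplus v) (Hplus v) g by move=> z zH; apply: HplusB; [|exact: w2H|exact: fH].
have g_lin : linear_on (Hplus v) g.
  move=> c z1 z2 H1 H2; rewrite /g w2_lin // f_lin // opprD addrACA.
  by rewrite scalerBr.
have g_half : bounded_by v g 2^-1.
  have fg_lin : linear_on (Hplus v) (fun x => f x - w2 x).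
    by move=> c z1 z2 H1 H2; rewrite w2_lin // f_lin // opprD addrACA scalerBr.
  move=> z D zH zD i; rewrite -[g z i]opprK (absN v_abs).
  have -> : - g z i = (f z - w2 z) i by rewrite -[RHS]/(f z i - w2 z i) /g opprB.
  apply: (bounded_by_opnorm v_abs fg_lin) => // z' H'.
  by have [] : Hplus v (f z' - w2 z') by apply: HplusB; [|exact: fH|exact: w2H].
have /choice[inv invP] b : exists z, Hplus v b ->
    [/\ Hplus v z, coef_bound v (Hnorm v b) z & z + g z = b].
  have [bH|nbH] := pselect (Hplus v b); last by exists 0.
  have bD : coef_bound v (Hnorm v b) b by move=> i; apply: Hnorm_ge; case: bH.
  by have [z zP] := neumann v_abs v_complete gH g_lin g_half bH bD; exists z.
have inv_lin c b1 b2 : Hplus v b1 -> Hplus v b2 ->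
    inv (c *: b1 + b2) = c *: inv b1 + inv b2.
  move=> H1 H2; have [z1 _ E1] := invP b1 H1; have [z2 _ E2] := invP b2 H2.
  have H3 := Hplus_lin v_abs c H1 H2; have [z3 _ E3] := invP _ H3.
  have z4 := Hplus_lin v_abs c z1 z2.
  apply/eqP; rewrite -subr_eq0; apply/eqP.
  apply: (neumann_inj v_abs g_lin g_half); first exact: HplusB.
  rewrite (linear_onB g_lin) // addrACA E3 -opprD g_lin // addrACA -scalerDr E1 E2.
  by rewrite subrr.
have inv_bd b D : Hplus v b -> coef_bound v D b -> coef_bound v D (inv b).
  move=> bH bD; have [_ zb _] := invP b bH; apply: coef_bound_le zb.
  exact: Hnorm_le.
have [js jsP] := separating_coordinates es.
pose phi k b : K := f (inv b) (nth 0 js k).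
have phiP k : bounded_functional (phi k).
  split=> [c b1 b2 H1 H2|].
    have [z1 _ _] := invP b1 H1; have [z2 _ _] := invP b2 H2.
    by rewrite /phi inv_lin // f_lin.
  exists C => // b D bH bD; have [zH _ _] := invP b bH.
  exact: fC _ _ zH (inv_bd _ _ bH bD) _.
pose b := x + w2 x; have bH : Hplus v b by apply: HplusD => //; exact: w2H.
have [p [[pH [N pN]] pphi pe]] := Tpolynomial_interpolation (size js) phiP bH e0.
have bpH : Hplus v (b - p) by exact: HplusB.
have [dH _ dE] := invP _ bpH; set d := inv (b - p) in dH dE.
have de : coef_bound v e d by exact: inv_bd.
have fd0 : f d = 0.
  have [|c cE] := esP (f d); first by exists d.
  rewrite cE; apply: jsP => j jjs; rewrite -cE.
  have := pphi (index j js); rewrite index_mem jjs => /(_ isT).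
  rewrite /phi nth_index // => fE; have [zb _ _] := invP b bH; have [zp _ _] := invP p pH.
  rewrite /d addrC -scaleN1r inv_lin // f_lin //.
  by rewrite -[LHS]/(-1 * f (inv p) j + f (inv b) j) fE mulN1r addNr.
have w2d : d + w2 d = b - p by rewrite -dE /g fd0 subr0.
have xdH : Hplus v (x - d) by exact: HplusB.
have uxd : (x - d) + w2 (x - d) = p.
  rewrite (linear_onB w2_lin) // addrACA -opprD w2d -/b opprB addrC subrK.
  by [].
exists (w (x - d)).
  split; first by exists (x - d).
  exists (N%:Z - i0) => i lt_i; rewrite -[i](addrK i0).
  rewrite -[w (x - d) _]/(Tshift i0 (w (x - d)) (i + i0)) wE // uxd.
  have [_ w1x] := w1H _ xdH.
  by rewrite -[LHS]/(w1 (x - d) (i + i0) + p (i + i0)) w1x ?pN ?addr0 //; lia.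
rewrite -(linear_onB w_lin) // opprB addrC subrK => i.
rewrite -[i](addrK i0) -[w d _]/(Tshift i0 (w d) (i + i0)) wE //.
have bd1 k : linear_on (Hplus v) k -> (forall z, Hplus v z -> Hspace v (k z)) ->
    (opnorm v k <= 1)%E -> coef_bound v e (k d).
  by move=> k_lin kH k1; rewrite -[e]mul1r; exact: (bounded_by_opnorm v_abs).
apply: coef_boundD => //; first by apply: bd1 => // z /w1H [].
by apply: coef_boundD => //; apply: bd1 => // z /w2H [].
Qed.

End Density.

(** * Vanishing *)

Section StandardBasis.
Variables (R : realType) (K : fieldType) (v : K -> R).
Hypothesis v_abs : nonarchimedean_abs v.
Implicit Types (x y : biseries K).

Definition gap_controlled (s : nat -> int) y :=
  forall t C, 0 <= C -> (forall j, t <> s j) ->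
  (forall j, t < s j -> v (y (s j)) <= C) -> v (y t) <= C.

Lemma gap_controlled_span (V : set (biseries K)) x :
  {homo sdeg V : i j / (i < j)%N >-> i < j} -> strictly_integral v V -> V x ->
  gap_controlled (sdeg V) x.
Proof.
move=> s_inc [b [[_ gen _] deg std] b_int] Vx t C C0 gap xC.
have [n [c xE]] := gen x Vx.
have evalE t' : x t' = \sum_(i < n) c i * b i t'.
  rewrite xE; elim/big_rec2: _ => [//|i z1 z2 _ <-]; by [].
have coefE (j : 'I_n) : x (sdeg V j) = c j.
  rewrite evalE (bigD1 j) //= (deg j).2 mulr1 big1 ?addr0 // => i ij.
  have [lt_ij|lt_ji|/val_inj E] := ltngtP i j; last by rewrite E eqxx in ij.
    by rewrite (deg i).1.2 ?mulr0 //; exact: s_inc.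
  by rewrite std ?mulr0.
rewrite evalE (abs_sum_le v_abs) // => i _.
have [lt_t|] := ltP t (sdeg V i).
  by rewrite -(mulr1 C) (absM_le v_abs) // -coefE xC.
rewrite le_eqVlt => /orP[/eqP E|lt_s]; first by have := gap i; rewrite E.
by rewrite (deg i).1.2 // mulr0 (abs0 v_abs).
Qed.

Lemma gap_controlled_limit (s : nat -> int) y :
  (forall e, 0 < e -> exists2 y', gap_controlled s y' & coef_bound v e (y - y')) ->
  gap_controlled s y.
Proof.
move=> lim t C C0 gap yC; apply/ler_addgt0Pr => e e0.
have [y' gap' close] := lim e e0.
have Ce : 0 <= C + e by rewrite addr_ge0 // ltW.
have closeC t' : v (y t' - y' t') <= C + e.
  by rewrite (le_trans (close t')) // lerDr.
apply: (abs_le_of_diff v_abs (closeC t)); apply: gap' => // j lt_j.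
apply: (abs_le_of_diff v_abs (y := y (s j))); first by rewrite (absBC v_abs).
by rewrite (le_trans (yC j lt_j)) // lerDl ltW.
Qed.

End StandardBasis.

Section Convolution.
Variables (R : realType) (K : fieldType) (v : K -> R).
Hypothesis v_abs : nonarchimedean_abs v.
Hypothesis v_complete : forall u, abs_cauchy v u -> exists l, abs_cvg v u l.

Definition conv_partial (f : nat -> K) (y : biseries K) (n : int) (N : nat) : K :=
  \sum_(k < N.+1) f k * y (n - k%:Z).

Lemma Hmul_partial (f : nat -> K) (y : biseries K) n N :
  \sum_(k < N.*2.+1)
    (let i := k%:Z - N%:Z in (of_ps f i : K) * y (n - i)) = conv_partial f y n N.
Proof.
rewrite -(big_mkord xpredT (fun k => (of_ps f (k%:Z - N%:Z) : K) * y (n - (k%:Z - N%:Z)))).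
rewrite (@big_cat_nat _ _ _ N) //=; last by lia.
rewrite [X in X + _]big_nat_cond [X in X + _]big1 => [|k /andP[/andP[_ kN] _]].
  rewrite add0r -[X in \sum_(X <= _ < _) _]add0n big_addn.
  have -> : (N.*2.+1 - N = N.+1)%N by lia.
  rewrite big_mkord; apply: eq_bigr => k _.
  by have -> : (k + N)%N%:Z - N%:Z = k%:Z by lia.
case E : (k%:Z - N%:Z) => [m|m] /=; last by rewrite mul0r.
by exfalso; lia.
Qed.

Lemma Hmul_cvg (f : nat -> K) (y : biseries K) rho n :
  0 <= rho < 1 -> (forall k, v (f k) <= rho ^+ k) -> Hspace v y ->
  abs_cvg v (conv_partial f y n) (Hmul v (of_ps f) y n).
Proof.
move=> /andP[rho0 rho1] fle /(HspaceP v_abs)[[D yD] _].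
have D0 := coef_bound_ge0 v_abs yD; have D1 : 0 < D + 1 by rewrite ltr_wpDl.
have [l cvl] : exists l, abs_cvg v (conv_partial f y n) l.
  apply: v_complete; apply: (abs_cauchy_of_steps v_abs) => e e0.
  have : `|rho| < 1 by rewrite ger0_norm.
  move/cvg_expr/cvgr0Pnorm_lt/(_ _ (divr_gt0 e0 D1)) => [N _ Ne]; exists N => m Nm.
  rewrite /conv_partial big_ord_recr /= [X in X - _]addrC addrK.
  have /= := Ne m.+1 (leqW Nm); rewrite ger0_norm ?exprn_ge0 // ltr_pdivlMr //.
  apply: le_lt_trans; rewrite (absM_le v_abs) // (le_trans (yD _)) // lerDl //.
rewrite /Hmul (_ : (fun N => _) = conv_partial f y n); last first.
  by apply/funext => N; exact: Hmul_partial.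
by rewrite (abs_lim_eq v_abs cvl).
Qed.

End Convolution.

Section Vanishing.
Variables (R : realType) (K : fieldType) (v : K -> R).
Hypothesis v_abs : nonarchimedean_abs v.
Variables (f : nat -> K) (rho : R) (kappa : int_partition) (e : int) (y : biseries K).
Hypotheses (rho_gt0 : 0 < rho) (rho_lt1 : rho < 1).
Hypotheses (f0 : f 0%N = 1) (f_le : forall k, v (f k) <= rho ^+ k).
Let s (j : nat) : int := j.+1%:Z - e - (kappa j)%:Z.
Hypothesis y_gap : gap_controlled v s y.
Let l := plength kappa.

Lemma conv_remainder n C (z : K) (y' : biseries K) :
  abs_cvg v (conv_partial f y n) 0 ->
  (exists N0, forall N, (N0 <= N)%N ->
     conv_partial f y n N = z + \sum_(k < N.+1) f k * y' (n - k%:Z)) ->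
  0 <= C -> (forall k, v (f k * y' (n - k%:Z)) <= C) -> v z <= C.
Proof.
move=> cv [N0 split0] C0 small.
apply: (abs_cvg_le v_abs (u := fun N => z + conv_partial f y n N * (-1))).
  have := abs_cvgD v_abs (abs_cvg_cst v_abs z) (abs_cvgMr v_abs (-1) cv).
  by rewrite mul0r addr0.
exists N0 => N /split0 ->; rewrite mulrN1 opprD addrA subrr add0r (absN v_abs).
by apply: (abs_sum_le v_abs) => // k _; exact: small.
Qed.

Lemma s_large j : (l <= j)%N -> s j = j.+1%:Z - e.
Proof. by rewrite /s -plengthP => /eqP ->; rewrite subr0. Qed.

Lemma s_inj i j : s i = s j -> i = j.
Proof.
rewrite /s; have [ij|ji|//] := ltngtP i j.
  by have := part_noninc kappa (ltnW ij); lia.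
by have := part_noninc kappa (ltnW ji); lia.
Qed.

Let alpha (j : nat) : R := rho ^ ((kappa j)%:Z - j%:Z).
Let mu : R := \big[Num.max/0]_(j < l) (v (y (s j)) * alpha j).

Let alpha_gt0 j : 0 < alpha j. Proof. exact: exprz_gt0. Qed.

Let mu_ge0 : 0 <= mu. Proof. exact: bigmax_ge_id. Qed.

Lemma le_mu (j : 'I_l) : v (y (s j)) * alpha j <= mu.
Proof. exact: (le_bigmax _ (fun j : 'I_l => v (y (s j)) * alpha j)). Qed.

Lemma exprz_rho_le (m n : int) : m <= n -> rho ^ n <= rho ^ m.
Proof.
move=> mn; rewrite -(subrK m n) expfzDr ?gt_eqF // ler_piMl ?exprz_ge0 ?(ltW rho_gt0) //.
have : 0 <= n - m by rewrite subr_ge0.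
by case: (n - m) => // k _; rewrite -exprnP exprn_ile1 // ltW.
Qed.

Lemma coef_s_le m k d (j : 'I_l) : m%:Z + 1 - e - s j + d%:Z <= k%:Z ->
  rho ^+ k * v (y (s j)) <= rho ^+ (m + d) * mu.
Proof.
move=> le_k; apply: (@le_trans _ _ (rho ^+ (m + d) * (v (y (s j)) * alpha j))).
  rewrite [v _ * _]mulrC mulrA ler_wpM2r ?(abs_ge0 v_abs) //.
  rewrite -[rho ^+ (m + d)]/(rho ^ (m + d)%N) -expfzDr ?gt_eqF //.
  rewrite -[rho ^+ k]/(rho ^ k%:Z); apply: exprz_rho_le; move: le_k; rewrite /s; lia.
by rewrite ler_wpM2l ?exprn_ge0 ?(ltW rho_gt0) // le_mu.
Qed.

Lemma gap_term_le m k d nu (X : R) :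
  let t := m%:Z + 1 - e - k%:Z in
  (forall j, t <> s j) -> (forall i : int, l%:Z - e < i -> v (y i) <= nu) ->
  rho ^+ k * nu <= X -> rho ^+ (m + d) * mu <= X -> (d <= 1)%N ->
  v (f k * y t) <= X.
Proof.
move=> t gap nuP kX mX d1; have rk : 0 < rho ^+ k by rewrite exprn_gt0.
have X0 : 0 <= X by apply: le_trans mX; rewrite mulr_ge0 // exprn_ge0 // ltW.
have -> : X = rho ^+ k * (X / rho ^+ k) by rewrite mulrCA divff ?gt_eqF // mulr1.
rewrite (absM_le v_abs) //; apply: y_gap => // [|j lt_j].
  by rewrite divr_ge0 // ltW.
rewrite ler_pdivlMr // mulrC; have [jl|lj] := ltnP j l.
  apply: le_trans mX; apply: (coef_s_le (j := Ordinal jl)) => /=.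
  by move: lt_j; rewrite /t; lia.
apply: le_trans kX; rewrite ler_wpM2l ?(ltW rk) //; apply: nuP.
by rewrite s_large //; lia.
Qed.

Hypothesis y_bounded : exists D, coef_bound v D y.
Hypothesis rows : forall n, - e < n -> abs_cvg v (conv_partial f y n) 0.

Lemma tail_le i : l%:Z - e < i -> v (y i) <= rho ^+ l * mu.
Proof.
pose S := [set v (y i) | i in [set i : int | l%:Z - e < i]].
have S_ub : has_ubound S by have [D yD] := y_bounded; exists D => _ [j _ <-].
set nu := sup S.
have nuP j : l%:Z - e < j -> v (y j) <= nu by move=> lj; apply: ub_le_sup => //; exists j.
have lt0 : l%:Z - e < l%:Z + 1 - e by lia.
have nu0 : 0 <= nu := le_trans (abs_ge0 v_abs _) (nuP _ lt0).
suff nu_le : nu <= Num.max (rho * nu) (rho ^+ l * mu).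
  move=> li; apply: le_trans (nuP _ li) _.
  move: nu_le; rewrite le_max => /orP[|//].
  rewrite -subr_ge0 -[X in rho * nu - X]mul1r -mulrBl => le0.
  suff -> : nu = 0 by rewrite mulr_ge0 // exprn_ge0 // ltW.
  apply/eqP; rewrite eq_le nu0 andbT leNgt; apply/negP => nu_gt0.
  by move: le0; rewrite pmulr_lge0 // subr_ge0 leNgt rho_lt1.
set X := Num.max _ _.
have X0 : 0 <= X by rewrite le_max mulr_ge0 // ltW.
apply: ge_sup => [|_ [n ln <-]]; first by exists (v (y (l%:Z + 1 - e))), (l%:Z + 1 - e).
have [m mE lm] : exists2 m : nat, n = (m%:Z + 1 - e)%R & (l <= m)%N.
  by exists `|(n + e - 1)%R|%N; move: ln => /=; lia.
pose y' : biseries K := fun i => if i == n then 0 else y i.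
apply: (@conv_remainder n X (y n) y') => [||//|k].
- by apply: rows; move: ln => /=; lia.
- exists 0%N => N _; rewrite /conv_partial !(big_ord_recl N) /= subr0 f0 mul1r.
  rewrite /y' eqxx mulr0 add0r; congr (_ + _); apply: eq_bigr => k _.
  by rewrite ifF //; apply/eqP; rewrite /bump /=; lia.
rewrite /y'; case: eqVneq => [_|kn]; first by rewrite mulr0 (abs0 v_abs).
have k0 : (0 < k)%N by case: (k) kn => // /eqP; rewrite subr0.
have kle : rho ^+ k <= rho by rewrite ler_iXnr // ltW.
have knu : rho ^+ k * nu <= X by rewrite le_max ler_wpM2r.
have mmu d : rho ^+ (m + d) * mu <= X.
  rewrite le_max; apply/orP; right; rewrite ler_wpM2r // ler_wiXn2l ?(ltW rho_gt0) ?(ltW rho_lt1) //.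
  exact: leq_trans lm (leq_addr _ _).
have [lt_l|le_l] := ltP (l%:Z - e) (n - k%:Z).
  by apply: le_trans knu; rewrite (absM_le v_abs) // nuP.
rewrite mE; have [[j E]|gap] := pselect (exists j, m%:Z + 1 - e - k%:Z = s j).
  have jl : (j < l)%N.
    by rewrite ltnNge; apply/negP => lj; have E' := s_large lj; lia.
  rewrite E (absM v_abs) (le_trans _ (mmu 0%N)) //.
  apply: le_trans (coef_s_le (j := Ordinal jl) (k := k) _) => /=; last by lia.
  by rewrite ler_wpM2r ?(abs_ge0 v_abs).
apply: (gap_term_le (d := 0)) knu (mmu _) _ => // j E; apply: gap; by exists j.
Qed.

Lemma head_row_le (m : 'I_l) :
  v (\sum_(i < l) (of_ps f ((kappa i)%:Z - i%:Z + m%:Z) : K) * y (s i))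
  <= rho ^+ m.+1 * mu.
Proof.
set n := m%:Z + 1 - e; have ml := ltn_ord m.
pose y' : biseries K := fun t => y t - \sum_(i < l) (t == s i)%:R * y (s i).
have X0 : 0 <= rho ^+ m.+1 * mu by rewrite mulr_ge0 // exprn_ge0 // ltW.
apply: (@conv_remainder n _ _ y') => [||//|k].
- by apply: rows; rewrite /n; lia.
- exists (\max_(i < l) `|n - s i|%N) => N maxN.
  rewrite /conv_partial (eq_bigr (fun k : 'I_N.+1 =>
    \sum_(i < l) f k * ((n - k%:Z == s i)%:R * y (s i)) + f k * y' (n - k%:Z))); last first.
    by move=> k _; rewrite -mulr_sumr -mulrDr [X in _ = _ * X]addrC /y' subrK.
  rewrite big_split exchange_big /=; congr (_ + _); apply: eq_bigr => i _.
  have := leq_trans (leq_bigmax i) maxN.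
  have -> : (kappa i)%:Z - i%:Z + m%:Z = n - s i by rewrite /n /s; lia.
  case E : (n - s i) => [q|q] /= le_N.
    have qN : (q < N.+1)%N by [].
    rewrite (bigD1 (Ordinal qN)) //= big1 => [|k kq].
      by rewrite addr0 (_ : (_ == _) = true) ?mul1r //; apply/eqP; lia.
    rewrite (_ : (_ == _) = false) ?mul0r ?mulr0 //; apply/eqP => E'.
    by move/eqP: kq; apply; apply: val_inj => /=; lia.
  rewrite mul0r big1 // => k _.
  by rewrite (_ : (_ == _) = false) ?mul0r ?mulr0 //; apply/eqP; lia.
have [[j E]|gap] := pselect (exists j, n - k%:Z = s j).
  have jl : (j < l)%N.
    by rewrite ltnNge; apply/negP => lj; move: E; rewrite s_large // /n; lia.
  rewrite /y' E (bigD1 (Ordinal jl)) //= eqxx mul1r big1 ?addr0 ?subrr ?mulr0 ?(abs0 v_abs) //.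
  move=> i ij; rewrite (_ : (_ == _) = false) ?mul0r //; apply/eqP => /s_inj E'.
  by move/eqP: ij; apply; exact: val_inj.
rewrite /y' big1 ?subr0 => [|i _]; last first.
  by rewrite (_ : (_ == _) = false) ?mul0r //; apply/eqP => E; apply: gap; exists i.
apply: (gap_term_le (d := 1) (nu := rho ^+ l * mu)); rewrite ?addn1 //.
- by move=> j E; apply: gap; exists j.
- exact: tail_le.
- rewrite mulrA -exprD ler_wpM2r // ler_wiXn2l ?(ltW rho_gt0) ?(ltW rho_lt1) //.
  by rewrite (leq_trans ml) // leq_addl.
Qed.

Hypothesis schurE : v (schur kappa (of_ps f)) = rho ^+ pweight kappa.

Lemma head_le (i : 'I_l) : v (y (s i)) * alpha i <= rho * mu.
Proof.
pose S : 'M[K]_l := \matrix_(i, j) (of_ps f ((kappa i)%:Z - i%:Z + j%:Z) : K).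
pose c : 'rV[K]_l := \row_i y (s i).
pose A : 'M[K]_l := \matrix_(i', j) if i' == i then (c *m S) 0 j else S i' j.
have detA : \det A = y (s i) * \det S.
  have -> : y (s i) * \det S = (c *m S *m \adj S) 0 i.
    by rewrite -mulmxA mul_mx_adj mul_mx_scalar !mxE mulrC.
  rewrite (expand_det_row A i) mxE; apply: eq_bigr => j _.
  rewrite [A i j]mxE eqxx [\adj S j i]mxE; congr (_ * _).
  rewrite /cofactor; congr (_ * \det _); apply/matrixP => i' j'.
  by rewrite !mxE eq_sym (negPf (neq_lift _ _)).
pose r (i' : 'I_l) : R := if i' == i then rho * mu else alpha i'.
have rho0 := ltW rho_gt0.
have le_det : v (\det A) <= (\prod_i' r i') * \prod_(j < l) rho ^+ j.
  apply: (abs_det_le v_abs) => [i'|j|i' j].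
  - by rewrite /r; case: ifP => _; [rewrite mulr_ge0 | exact: ltW].
  - exact: exprn_ge0.
  rewrite /A mxE /r; case: ifP => _.
    rewrite mxE mulrAC -exprS; apply: le_trans (head_row_le j).
    rewrite le_eqVlt; apply/orP; left; apply/eqP; congr v.
    by apply: eq_bigr => i'' _; rewrite !mxE mulrC.
  rewrite mxE -[rho ^+ j]/(rho ^ j%:Z) -expfzDr ?gt_eqF //.
  by case: (_ + j%:Z) => q /=; rewrite ?f_le // (abs0 v_abs) exprz_ge0.
have prodE : v (\det S) = (\prod_(i < l) alpha i) * \prod_(j < l) rho ^+ j.
  rewrite -[\det S]/(schur kappa (of_ps f)) schurE pweightE -prodrXr -big_split.
  apply: eq_bigr => i' _ /=.
  by rewrite -[rho ^+ i']/(rho ^ i'%:Z) -expfzDr ?gt_eqF // subrK.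
move: le_det; rewrite detA (absM v_abs) prodE mulrA ler_pM2r; last first.
  by apply: prodr_gt0 => j _; exact: exprn_gt0.
rewrite (bigD1 i) //= [X in _ <= X](bigD1 i) //= /r eqxx mulrA.
rewrite [X in _ <= _ * X](eq_bigr (fun i' : 'I_l => alpha i')).
  by rewrite ler_pM2r // prodr_gt0.
by move=> i' /negPf ->.
Qed.

Lemma conv_eq0 : y = 0.
Proof.
have rho0 := ltW rho_gt0.
have mu0 : mu = 0.
  have : mu <= rho * mu by apply: bigmax_le => [|i _]; [rewrite mulr_ge0 | exact: head_le].
  rewrite -subr_ge0 -[X in _ - X]mul1r -mulrBl => le0.
  apply/eqP; rewrite eq_le mu_ge0 andbT leNgt; apply/negP => mu_gt0.
  by move: le0; rewrite pmulr_lge0 // subr_ge0 leNgt rho_lt1.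
have tail i : l%:Z - e < i -> v (y i) <= 0.
  by move=> /tail_le; rewrite mu0 mulr0.
have head j : v (y (s j)) <= 0.
  have [jl|lj] := ltnP j l; last by apply: tail; rewrite s_large //; lia.
  by have := le_mu (Ordinal jl); rewrite mu0 pmulr_lle0.
apply: (coef_bound_eq0 v_abs) => eps eps0 t; rewrite (@le_trans _ _ 0) ?(ltW eps0) //.
have [[j ->]|gap] := pselect (exists j, t = s j); first exact: head.
by apply: y_gap => // j E; apply: gap; exists j.
Qed.

End Vanishing.

(** * The action on the Grassmannian *)

Section Grassmannian.
Variables (R : realType) (K : fieldType) (v : K -> R).
Hypothesis v_abs : nonarchimedean_abs v.
Hypothesis v_complete : forall u, abs_cauchy v u -> exists l, abs_cvg v u l.

Lemma Hmul0r (f : nat -> K) : Hmul v (of_ps f) 0 = 0.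
Proof.
apply/funext => n; rewrite /Hmul (_ : (fun N => _) = fun=> 0).
  exact: (abs_lim_eq v_abs (abs_cvg_cst v_abs 0)).
by apply/funext => N; rewrite big1 // => k _; exact: mulr0.
Qed.

Lemma Gr_an0 (W : set (biseries K)) : Gr_an v W -> W 0.
Proof.
move=> [w [_ w_lin _ -> _]]; exists 0; first exact: Hplus0.
exact: linear_on0 w_lin.
Qed.

Lemma Gr_an_Hspace (W : set (biseries K)) y : Gr_an v W -> W y -> Hspace v y.
Proof. by move=> [w [wH _ _ -> _]] [x /wH + <-]. Qed.

Lemma Hact_alg_trivial (f : nat -> K) (rho : R) (kappa : int_partition) W :
  0 < rho < 1 -> f 0%N = 1 -> (forall n, v (f n) <= rho ^+ n) ->
  v (schur kappa (of_ps f)) = rho ^+ pweight kappa ->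
  Gr_an v W -> strictly_integral v (alg W) ->
  (forall j, (kappa j)%:Z = kappa_of (alg W) j) ->
  alg (Hact v (of_ps f) W) `&` Tpow_Kinv (- gr_index (alg W)) = [set 0].
Proof.
move=> /andP[rho0 rho1] f0 fle schurE WGr W_int kE.
set e := gr_index (alg W).
have sE : sdeg (alg W) = fun j => j.+1%:Z - e - (kappa j)%:Z.
  by apply/funext => j; rewrite kE /kappa_of -/e; ring.
have s_inc : {homo sdeg (alg W) : i j / (i < j)%N >-> i < j}.
  by move=> i j ij; rewrite sE; have := part_noninc kappa (ltnW ij); lia.
apply/seteqP; split=> [x [[[y Wy <-] _] xe]|_ ->]; last first.
  split; last by [].
  split; last by exists 0.
  by exists 0; [exact: Gr_an0 | exact: Hmul0r].
have yH := Gr_an_Hspace WGr Wy.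
have gap : gap_controlled v (sdeg (alg W)) y.
  apply: (gap_controlled_limit v_abs) => eps eps0.
  have [y' y'W close] := alg_dense v_abs v_complete WGr Wy eps0.
  by exists y' => //; exact: (gap_controlled_span v_abs).
rewrite sE in gap.
have rows n : - e < n -> abs_cvg v (conv_partial f y n) 0.
  have cv : abs_cvg v (conv_partial f y n) (Hmul v (of_ps f) y n).
    by apply: (Hmul_cvg v_abs v_complete n _ fle yH); rewrite rho1 ltW.
  by move=> en; rewrite -[X in abs_cvg _ _ X](xe n en).
have yb : exists D, coef_bound v D y by have /(HspaceP v_abs)[] := yH.
by rewrite (conv_eq0 v_abs rho0 rho1 f0 fle gap yb rows schurE) /= Hmul0r.
Qed.

End Grassmannian.

Lemma padic_abs_nat (R : realType) p n : (0 < n)%N ->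
  padic_abs R p n%:R = (p%:R ^+ logn p n)^-1.
Proof.
move=> n0; rewrite /padic_abs pnatr_eq0 gtn_eqF //.
have -> : n%:R = n%:Z%:~R :> rat by rewrite -pmulrn.
by rewrite numq_int denq_int /= logn1 expr0 mul1r.
Qed.

Lemma abs_nat_Qp (R : realType) p (Qp : fieldType) (vQ : Qp -> R) (K : fieldExtType Qp)
    (v : K -> R) : is_Qp p vQ -> (forall a : Qp, v a%:A = vQ a) ->
  forall n, (0 < n)%N -> v n%:R = (p%:R ^+ logn p n)^-1.
Proof.
move=> QpP v_ext n n0; rewrite -(padic_abs_nat R p n0) -(Qp_rat QpP) ratr_nat.
by rewrite -v_ext scaler_nat.
Qed.

Theorem proposition3p6 (R : realType) (p : nat) (p_prime : prime p)
    (Qp : fieldType) (vQ : Qp -> R) (QpP : is_Qp p vQ)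
    (K : fieldExtType Qp) (v : K -> R) (v_abs : nonarchimedean_abs v)
    (v_ext : forall a : Qp, v (a%:A) = vQ a)
    (h : biseries K) (rho : R) (kappa : int_partition) :
  (exists pi : K,
     [/\ pi <> 0, v pi < 1, h = of_ps (hseries p pi), rho = v pi &
         (kappa 0%N + plength kappa <= p)%N])
  \/
  (exists (g : nat) (pi : 'I_g -> K) (last : 'I_g),
     [/\ (0 < g < p)%N /\ last.+1 = g,
         forall i, v (pi i) < 1,
         forall i, v (pi i) <= v (pi last),
         h = of_ps (hmuseries p (fun i : 'I_g => i.+1) pi)
           /\ rho = v (pi last) `^ (g%:R^-1) &
         forall i, kappa i = if i == 0%N then g else 0%N]) ->
  [/\ Gamma_plus v h /\ Gamma_rho v rho h,
      v (schur kappa h) = rho ^+ pweight kappa &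
      0 < rho ->
      forall W : set (biseries K),
        Gr_an v W -> strictly_integral v (alg W) ->
        (forall j, (kappa j)%:Z = kappa_of (alg W) j) ->
        alg (Hact v h W) `&` Tpow_Kinv (- gr_index (alg W)) = [set 0]].
Proof.
move=> hyp; have v_nat := abs_nat_Qp QpP v_ext.
have v_complete := complete_fieldExt (Qp_abs QpP) (Qp_complete QpP) v_abs v_ext.
suff [f [-> f0 fle /andP[rho0 rho1] schurE]] : exists f : nat -> K,
    [/\ h = of_ps f, f 0%N = 1, forall n, v (f n) <= rho ^+ n, 0 <= rho < 1 &
        v (schur kappa h) = rho ^+ pweight kappa].
  split; [|exact: schurE|].
    by apply: (Gamma_of_ps v_abs) => //; rewrite rho0.
  move=> rho_gt0 W; apply: (Hact_alg_trivial v_abs v_complete) => //.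
  by rewrite rho_gt0.
case: hyp => [[pi [/eqP pi0 pi1 -> -> kp]]|].
  exists (hseries p pi); split=> //.
  - exact: hseries0.
  - by move=> n; exact: abs_hseries_le p_prime v_abs v_nat _ _.
  - by rewrite (abs_ge0 v_abs).
  - exact: abs_schur_hseries p_prime v_abs v_nat _ _ pi0 kp.
move=> [g [pi [last [[/andP[g0 gp] lastE] pi1 pile [-> rhoE] kE]]]].
have rho0 : 0 <= rho by rewrite rhoE powR_ge0.
have rhog : rho ^+ g = v (pi last).
  rewrite rhoE -powR_mulrn ?powR_ge0 // -powRrM mulVf ?powRr1 ?(abs_ge0 v_abs) //.
  by rewrite pnatr_eq0 -lt0n.
have rho1 : rho < 1.
  by rewrite ltNge; apply/negP => /(exprn_ege1 g); rewrite rhog leNgt pi1.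
have mu_le i : v (pi i) <= rho ^+ i.+1.
  by rewrite (le_trans (pile i)) // -rhog ler_wiXn2l // ltW.
have [schurE wE] := schur_row (of_ps (hmuseries p (fun i : 'I_g => i.+1) pi)) g0 kE.
exists (hmuseries p (fun i : 'I_g => i.+1) pi); split=> //.
- exact: hmuseries0.
- exact: abs_hmuseries_le p_prime v_abs v_nat _ _ _ _ _ mu_le.
- by rewrite rho0.
- by rewrite schurE wE rhog; exact: abs_hmuseries_top p_prime v_abs v_nat _ _ _ lastE _ _.
Qed.
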